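(* For every $\nu>0$, there exist an atomless $\sigma$-finite control space $(\mathcal Z,\mathscr Z,\mu)$, a Poisson random measure $\eta$ on it with control $\mu$, and $F_\nu\in\mathcal C_2^\eta$ such that $$\mathbb E[F_\nu^2]=2\nu,\qquad \mathbb E[F_\nu^3]=8\nu,\qquad \mathbb E[F_\nu^4]=12\nu^2+48\nu,$$ but $\mathcal L(F_\nu)\ne\mathcal L(Z_\nu)$ and $\mathcal J_4(F_\nu)>0$.
   Context: $\mathcal L(X)$ denotes the law of $X$. For a Poisson random measure $\eta$ with $\sigma$-finite control (intensity) measure $\mu$, $\widehat\eta=\eta-\mu$; $L^2_s(\mu^2)$ is the space of symmetric real kernels in $L^2(\mathcal Z^2,\mu^2)$, $I_2^\eta(f)$ is the double Wiener–Itô integral of $f\in L_s^2(\mu^2)$ with respect to $\widehat\eta$ (normalized by $\mathbb E[I_2^\eta(f)^2]=2\|f\|^2_{L^2(\mu^2)}$), and $\mathcal C_2^\eta=\{I_2^\eta(f):f\in L^2_s(\mu^2)\}$ is the second Poisson chaos. The add-one derivative is $D_zF=F(\eta+\delta_z)-F(\eta)$, and for $F\in L^4$, $\mathcal J_4(F)=\int_{\mathcal Z}\mathbb E[|D_zF|^4]\,\mu(dz)$. $Z_\nu=2X_{\nu/2,1}-\nu$, where $X_{\nu/2,1}$ is Gamma distributed with shape $\nu/2$ and rate $1$. *)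

(* Defs.v *)
From HB Require Import structures.
From mathcomp Require Import all_boot all_order all_algebra.
From mathcomp Require Import all_classical all_reals all_analysis.
From mathcomp Require Import measurable_realfun.

Set Implicit Arguments.
Unset Strict Implicit.
Unset Printing Implicit Defensive.

Import Order.TTheory GRing.Theory Num.Theory.
Import numFieldNormedType.Exports.

Local Open Scope classical_set_scope.
Local Open Scope ring_scope.

Definition atomless {d} {Z : measurableType d} {R : realType}
    (mu : set Z -> \bar R) : Prop :=
  forall A, measurable A -> (0 < mu A)%E ->
    exists B, [/\ measurable B, B `<=` A, (0 < mu B)%E & (mu B < mu A)%E].

Definition mutually_independent {d d'} {Omega : measurableType d}
    {T : measurableType d'} {R : realType} (P : probability Omega R)
    (n : nat) (X : 'I_n -> Omega -> T) : Prop :=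
  forall B : 'I_n -> set T, (forall i, measurable (B i)) ->
    P [set w | forall i, B i (X i w)] =
    \big[*%E/1%E]_(i < n) P (X i @^-1` B i).

(* The type of eta, a kernel, carries the measurability of w |-> eta w A.
   The Poisson law of infinite mean is the point mass at +oo.  In the library,
   poisson_prob r k is the Poisson law of mean r (the point mass at 0 for
   r = 0), and its argument k is not used. *)
Definition poisson_random_measure {dO dZ} {Omega : measurableType dO}
    {Z : measurableType dZ} {R : realType} (P : probability Omega R)
    (mu : set Z -> \bar R) (eta : R.-ker Omega ~> Z) : Prop :=
  [/\ (forall w, sigma_finite [set: Z] (eta w)) /\
      (forall w A, measurable A ->
         eta w A = +oo%E \/ exists k : nat, eta w A = k%:R%:E),
      (forall A, measurable A -> (mu A < +oo)%E -> forall k : nat,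
         P [set w | eta w A = k%:R%:E] = poisson_prob (fine (mu A)) 0 [set k]),
      (forall A, measurable A -> mu A = +oo%E ->
         P [set w | eta w A = +oo%E] = 1%E) &
      (forall (n : nat) (A : 'I_n -> set Z), (forall i, measurable (A i)) ->
         trivIset [set: 'I_n] A ->
         mutually_independent P (fun i w => eta w (A i)))].

(* Real-valued version of the compensated measure eta - mu, used on sets of
   finite mu-measure, where eta is almost surely finite. *)
Definition compensated {dO dZ} {Omega : measurableType dO}
    {Z : measurableType dZ} {R : realType} (mu : set Z -> \bar R)
    (eta : R.-ker Omega ~> Z) (A : set Z) (w : Omega) : R :=
  fine (eta w A) - fine (mu A).

(* Data of an elementary kernel sum_(i, j) a i j * 1_(A i) (x) 1_(A j) that is
   symmetric and vanishes on the diagonal. *)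
Record elementary_kernel {d} {Z : measurableType d} {R : realType}
    (mu : set Z -> \bar R) := ElementaryKernel {
  ek_size : nat ;
  ek_set : 'I_ek_size -> set Z ;
  ek_coef : 'M[R]_ek_size ;
  ek_measurable : forall i, measurable (ek_set i) ;
  ek_finite : forall i, (mu (ek_set i) < +oo)%E ;
  ek_disjoint : trivIset [set: 'I_ek_size] ek_set ;
  ek_sym : ek_coef^T = ek_coef ;
  ek_diag0 : forall i, ek_coef i i = 0 }.

Arguments ek_set {d Z R mu} _ _ _.
Arguments ek_coef {d Z R mu} _.

Definition ek_fun {d} {Z : measurableType d} {R : realType}
    {mu : set Z -> \bar R} (g : elementary_kernel mu) (z : Z * Z) : R :=
  \sum_(i < ek_size g) \sum_(j < ek_size g)
    ek_coef g i j * \1_(ek_set g i) z.1 * \1_(ek_set g j) z.2.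

Definition ek_integral {dO dZ} {Omega : measurableType dO}
    {Z : measurableType dZ} {R : realType} {mu : set Z -> \bar R}
    (eta : R.-ker Omega ~> Z) (g : elementary_kernel mu) (w : Omega) : R :=
  \sum_(i < ek_size g) \sum_(j < ek_size g)
    ek_coef g i j * compensated mu eta (ek_set g i) w
                  * compensated mu eta (ek_set g j) w.

Definition L2s {d} {Z : measurableType d} {R : realType}
    (mu : {sigma_finite_measure set Z -> \bar R}) : set (Z * Z -> R) :=
  [set f | f \in Lfun (mu \x mu)%E 2%:E /\ forall x y, f (x, y) = f (y, x)].

(* F is (a version of) I_2(f): the isometric extension from elementary kernels,
   which are dense in L2s when mu is atomless.  The normalization
   E[I_2(f)^2] = 2 ||f||^2 is the one holding for elementary kernels. *)
Definition is_I2 {dO dZ} {Omega : measurableType dO} {Z : measurableType dZ}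
    {R : realType} (P : probability Omega R)
    (mu : {sigma_finite_measure set Z -> \bar R}) (eta : R.-ker Omega ~> Z)
    (f : Z * Z -> R) (F : {RV P >-> R}) : Prop :=
  exists g : nat -> elementary_kernel mu,
    (\int[(mu \x mu)%E]_z ((ek_fun (g n) z - f z) ^+ 2)%:E
       @[n --> \oo] --> 0)%E /\
    ('E_P[fun w => ((ek_integral eta (g n) w - F w) ^+ 2)%R]
       @[n --> \oo] --> 0)%E.

Definition second_chaos {dO dZ} {Omega : measurableType dO}
    {Z : measurableType dZ} {R : realType} (P : probability Omega R)
    (mu : {sigma_finite_measure set Z -> \bar R}) (eta : R.-ker Omega ~> Z) :
    set {RV P >-> R} :=
  [set F | exists2 f, L2s mu f & is_I2 mu eta f F].

(* Sigma-algebra on the space of measures generated by the evaluations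
   m |-> m A. *)
Definition evaluation_sigma_algebra {d} (Z : measurableType d)
    (R : realType) : set (set {measure set Z -> \bar R}) :=
  <<s [set S | exists A (B : set (\bar R)), [/\ measurable A, measurable B &
         S = [set m : {measure set Z -> \bar R} | B (m A)] ] ] >>.

(* F = f(eta) almost surely.  Functionals are taken on all measures rather than
   on the integer-valued sigma-finite ones; every measurable real function on
   the latter extends measurably to the former. *)
Definition representative {dO dZ} {Omega : measurableType dO}
    {Z : measurableType dZ} {R : realType} (P : probability Omega R)
    (eta : R.-ker Omega ~> Z) (F : Omega -> R)
    (f : {measure set Z -> \bar R} -> R) : Prop :=
  (forall B : set R, measurable B -> evaluation_sigma_algebra (f @^-1` B)) /\
  {ae P, forall w, F w = f (eta w)}.

Definition add_point {d} {Z : measurableType d} {R : realType}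
    (m : {measure set Z -> \bar R}) (z : Z) : {measure set Z -> \bar R} :=
  measure_add m (dirac z).

(* D_z F, where f is a representative of F. *)
Definition add_one {dO dZ} {Omega : measurableType dO}
    {Z : measurableType dZ} {R : realType} (eta : R.-ker Omega ~> Z)
    (f : {measure set Z -> \bar R} -> R) (z : Z) (w : Omega) : R :=
  f (add_point (eta w) z) - f (eta w).

(* J_4(F), where f is a representative of F; by the Mecke formula the value
   does not depend on the choice of f. *)
Definition J4 {dO dZ} {Omega : measurableType dO} {Z : measurableType dZ}
    {R : realType} (P : probability Omega R) (mu : {measure set Z -> \bar R})
    (eta : R.-ker Omega ~> Z) (f : {measure set Z -> \bar R} -> R) : \bar R :=
  (\int[mu]_z 'E_P[fun w => (`|add_one eta f z w| ^+ 4)%R])%E.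

Definition Gamma_fun {R : realType} (a : R) : R :=
  \int[lebesgue_measure]_(x in `]0, +oo[) (x `^ (a - 1) * expR (- x)).

(* Gamma distribution with shape a and rate b. *)
Definition gamma_pdf {R : realType} (a b x : R) : R :=
  if 0 < x then b `^ a * x `^ (a - 1) * expR (- (b * x)) / Gamma_fun a else 0.

Definition gamma_prob {R : realType} (a b : R) (A : set R) : \bar R :=
  (\int[lebesgue_measure]_(x in A) (gamma_pdf a b x)%:E)%E.

(* Law of Z_nu = 2 X - nu, with X of Gamma law of shape nu / 2 and rate 1. *)
Definition centered_gamma_law {R : realType} (nu : R) : set R -> \bar R :=
  pushforward (gamma_prob (nu / 2) 1) (fun x : R => 2 * x - nu).

(* Equality of laws, tested on measurable sets only: the two set functions may
   differ on nonmeasurable sets. *)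
Definition same_law {d} {T : measurableType d} {R : realType}
    (m1 m2 : set T -> \bar R) : Prop :=
  forall A, measurable A -> m1 A = m2 A.

(* Main.v *)
Require Import Defs.
From mathcomp Require Import all_boot all_order all_algebra.
From mathcomp Require Import all_classical all_reals all_analysis.
From mathcomp Require Import measurable_realfun.
From HB Require Import structures.
From mathcomp Require Import ring lra.

(** The functional is a sum of n independent products of two independent
    compensated Poisson counts: F = sum_k 4 X_k Y_k, where X_k and Y_k are the
    compensated numbers of points in two intervals of lengths l and r, all 2n
    intervals being disjoint. It is the double integral of a step kernel, hence
    in the second chaos.

    The product 4 X Y is centred with second moment 16 lr, third moment 64 lr
    and fourth moment 256 (l + 3 l^2) (r + 3 r^2). Variance and third cumulant
    add up over the pairs, so both targets 2 nu and 8 nu amount to the single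
    equation 8 n lr = nu; this is where the factor 4 comes from. The fourth
    cumulant is then 48 nu as soon as 3 (l + r) + 6 lr = 1 / 2. For large n
    these two equations have a solution with 0 < r <= l < 1
    ([pair_lengths]).

    With positive probability there is no point at all. Hence F has an atom,
    which the gamma law, having a density, does not ([poisson_process_nil],
    [distribution_neq_centered_gamma]). If the first point falls in the
    interval of X_k, then F jumps by 4 (- r), the value of 4 Y_k on the empty
    configuration, and this makes J_4 positive ([paired_chaos_jump], [J4_gt0]).

    The Poisson process itself is built as a law on finite lists of points: n
    points drawn independently according to mu, weighted by exp (- mu Z) / n!.
    Its Mecke formula for numbers of points in finitely many cells ([mecke]) is
    an induction on n. It yields the joint law of these numbers, that is the
    axioms of a Poisson random measure ([poisson_process_counts],
    [poisson_process_is_prm]), and, applied to polynomials, all moments by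
    integration by parts ([mean_X], [mean_product_sum_pow]). *)

Set Implicit Arguments.
Unset Strict Implicit.
Unset Printing Implicit Defensive.
Import Order.TTheory GRing.Theory Num.Theory.
Import numFieldNormedType.Exports.

Local Open Scope classical_set_scope.
Local Open Scope ring_scope.

(** * Finite point configurations *)

Section configurations.
Context {d : measure_display} {Z : measurableType d}.

Definition npoints (A : set Z) (w : seq Z) : nat :=
  count (fun z => `[< A z >]) w.
Arguments npoints : simpl never.

Definition counting_sets : set (set (seq Z)) :=
  [set S | exists A k, measurable A /\ S = [set w | npoints A w = k] ].

(** Lists rather than multisets, with the sigma-algebra generated by the point
    counts: it does not see the order of the points. *)
Definition config := g_sigma_algebraType counting_sets.

HB.instance Definition _ := isPointed.Build (seq Z) [::].
HB.instance Definition _ := Measurable.on config.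

Lemma measurable_npoints (A : set Z) (K : set nat) :
  measurable A -> measurable ([set w | K (npoints A w)] : set config).
Proof.
move=> mA; rewrite [X in measurable X](_ : _ = \bigcup_(k in K)
    ([set w | npoints A w = k] : set config)); last first.
  by apply/seteqP; split=> [w Kw|w [k Kk /= ->] //]; exists (npoints A w).
apply: bigcup_measurable => k _; apply: sub_sigma_algebra.
by exists A, k.
Qed.

Lemma npoints_cons (A : set Z) z w :
  npoints A (z :: w) = (`[< A z >] + npoints A w)%N.
Proof. by []. Qed.

Lemma measurable_cons_config :
  measurable_fun [set: Z * config] (fun p => p.1 :: p.2 : config).
Proof.
apply: (@measurability _ _ _ config _ _ counting_sets) => //.
move=> _ [_ [A [k [mA ->]]] <-]; rewrite setTI.
rewrite [X in measurable X](_ : _ =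
  (A `*` [set w : config | (npoints A w).+1 = k]) `|`
  (~` A `*` [set w : config | npoints A w = k])); last first.
  apply/seteqP; split => [[z w] /=|[z w] /= [] [Az] <-].
  - rewrite npoints_cons; case: (asboolP (A z)) => Az /= <-; [left|right];
    by split.
  - by rewrite npoints_cons; case: asboolP.
  - by rewrite npoints_cons; case: asboolP.
apply: measurableU; apply: measurableX => //.
- exact: (measurable_npoints (fun n => n.+1 = k)).
- exact: measurableC.
- exact: (measurable_npoints (fun n => n = k)).
Qed.

Lemma measurable_cons_point (z : Z) :
  measurable_fun [set: config] (fun w : config => z :: w : config).
Proof.
exact: (measurableT_comp measurable_cons_config (pair1_measurable z)).
Qed.

Lemma measurable_set1_nil : measurable [set [::] : config].
Proof.
rewrite [X in measurable X](_ : _ = [set w : config | npoints setT w = 0%N]).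
  exact: (measurable_npoints (fun n => n = 0%N)).
apply/seteqP; split => [w -> //|[|z w] //=].
by rewrite npoints_cons asboolT.
Qed.

Lemma measurable_config1 : measurable_fun [set: Z] (fun z => [:: z] : config).
Proof.
exact: (measurableT_comp measurable_cons_config (pair2_measurable _)).
Qed.

Lemma measurable_fun_npoints (A : set Z) : measurable A ->
  measurable_fun [set: config] (npoints A).
Proof. by move=> mA _ K _; rewrite setTI; exact: measurable_npoints. Qed.

(** Written with add_point, so that adding a point to the measure of a
    configuration is by definition extending the list. *)
Fixpoint config_measure (R : realType) (w : seq Z) :
    {measure set Z -> \bar R} :=
  if w is z :: w' then add_point (config_measure R w') z else mzero.

Lemma config_measureE (R : realType) w (A : set Z) :
  config_measure R w A = (npoints A w)%:R%:E.
Proof.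
elim: w => [//|z w IH]; rewrite /= npoints_cons.
rewrite -/(add_point _ _) /add_point -[LHS]/(measure_add _ _ A) measure_addE.
rewrite -[X in (X + _)%E]/(config_measure R w A) IH natrD EFinD addeC.
congr (_ + _)%E.
Qed.

Section kernel.
Variable R : realType.

Let measurable_config_measure (A : set Z) : measurable A ->
  measurable_fun [set: config] (fun w : config => config_measure R w A).
Proof.
move=> mA; under eq_fun do rewrite config_measureE.
have mE : measurable_fun [set: nat] (fun k : nat => k%:R%:E : \bar R) by [].
exact: (measurableT_comp mE (measurable_fun_npoints mA)).
Qed.

HB.instance Definition _ := isKernel.Build _ _ config Z R
  (config_measure R : config -> _) measurable_config_measure.

Definition points_kernel : R.-ker config ~> Z :=
  (config_measure R : config -> _).

Lemma points_kernelE w A : points_kernel w A = (npoints A w)%:R%:E.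
Proof. exact: config_measureE. Qed.

End kernel.

End configurations.
Arguments config {d} Z.
Arguments points_kernel {d} Z R.

(** * Counts per colour *)

(** Splitting the space into finitely many cells c = i turns a configuration
    into the vector of its cell counts, whose law is discrete; everything
    needed about Poisson random measures is read off such vectors. *)
Section colours.
Context {d : measure_display} {Z : measurableType d} {I : finType}.
Variable c : Z -> I.
Hypothesis mc : forall i, measurable (c @^-1` [set i]).

Definition counts (w : seq Z) : {ffun I -> nat} :=
  [ffun i => count (fun z => c z == i) w].

Definition incr (i : I) (v : {ffun I -> nat}) : {ffun I -> nat} :=
  [ffun j => (i == j) + v j]%N.

Lemma counts_cons z w : counts (z :: w) = incr (c z) (counts w).
Proof. by apply/ffunP => i; rewrite !ffunE. Qed.

Lemma counts_nil : counts [::] = [ffun=> 0%N].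
Proof. by apply/ffunP => i; rewrite !ffunE. Qed.

Lemma counts_npoints i w : counts w i = npoints (c @^-1` [set i]) w.
Proof.
rewrite ffunE; apply: eq_count => z /=.
by apply/eqP/asboolP.
Qed.

Lemma measurable_counts (S : set {ffun I -> nat}) :
  measurable (counts @^-1` S : set (config Z)).
Proof.
rewrite [X in measurable X](_ : _ = \bigcup_(v in [set: {ffun I -> nat}])
   (if `[< S v >] then \bigcap_(i in [set: I])
       [set w : config Z | npoints (c @^-1` [set i]) w = v i] else set0)).
  apply: countable_bigcupT_measurable => [|v]; first exact: countableP.
  case: ifP => _ //; apply: fin_bigcap_measurable; first exact: finite_finset.
  move=> i _; exact: (measurable_npoints (fun k => k = v i)).
apply/seteqP; split => [w Sw|w [v _]].
  exists (counts w) => //; rewrite asboolT // => i _ /=.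
  by rewrite counts_npoints.
case: asboolP => // Sv w_v; rewrite /preimage /=.
suff -> : counts w = v by [].
by apply/ffunP => i; rewrite counts_npoints w_v.
Qed.

Lemma measurable_fun_counts d' (T : measurableType d')
    (h : {ffun I -> nat} -> T) :
  measurable_fun [set: config Z] (fun w : config Z => h (counts w)).
Proof.
by move=> _ Y _; rewrite setTI; exact: (measurable_counts (h @^-1` Y)).
Qed.

End colours.
(** * The Poisson process of finite intensity *)

Section add_random_point.
Context {d : measure_display} {Z : measurableType d} {R : realType}.
Variable mu : {finite_measure set Z -> \bar R}.
Implicit Types m : {finite_measure set (config Z) -> \bar R}.

Definition cons_config (p : Z * config Z) : config Z := p.1 :: p.2.

HB.instance Definition _ :=
  isMeasurableFun.Build _ _ _ _ cons_config measurable_cons_config.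

Definition add_random_point m : set (config Z) -> \bar R :=
  pushforward (mu \x m)%E cons_config.

Section instances.
Variable m : {finite_measure set (config Z) -> \bar R}.

Let add0 : add_random_point m set0 = 0%E.
Proof. exact: (@measure0 _ _ _ (pushforward (mu \x m)%E cons_config)). Qed.

Let add_ge0 A : (0 <= add_random_point m A)%E.
Proof. exact: (@measure_ge0 _ _ _ (pushforward (mu \x m)%E cons_config)). Qed.

Let add_sigma_additive : semi_sigma_additive (add_random_point m).
Proof.
exact: (@measure_semi_sigma_additive _ _ _ (pushforward (mu \x m)%E cons_config)).
Qed.

HB.instance Definition _ := isMeasure.Build _ _ _ (add_random_point m)
  add0 add_ge0 add_sigma_additive.

Lemma add_random_pointT :
  add_random_point m setT = (mu setT * m setT)%E.
Proof.
rewrite /add_random_point /pushforward preimage_setT -setXTT.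
by rewrite -[LHS]/((mu \x m)%E (setT `*` setT)) product_measure1E.
Qed.

Let add_fin : fin_num_fun (add_random_point m).
Proof.
apply: lty_fin_num_fun; have := add_random_pointT; rewrite /= => ->.
by rewrite ltey_eq fin_numM// fin_num_measure.
Qed.

HB.instance Definition _ := Measure_isFinite.Build _ _ _ (add_random_point m)
  add_fin.

End instances.

Lemma ge0_integral_add_random_point m (f : config Z -> \bar R) :
  measurable_fun setT f -> (forall w, 0 <= f w)%E ->
  (\int[add_random_point m]_w f w = \int[mu]_z \int[m]_w f (z :: w))%E.
Proof.
move=> mf f0; rewrite [LHS](ge0_integral_pushforward measurable_cons_config)//.
rewrite preimage_setT fubini_tonelli1//.
  exact: (measurableT_comp mf measurable_cons_config).
by move=> p; exact: f0.
Qed.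

(** Not normalized: the total mass is (mu setT) ^ n. *)
Fixpoint n_points_law (n : nat) : {finite_measure set (config Z) -> \bar R} :=
  if n is n'.+1 then add_random_point (n_points_law n')
  else \d_([::] : config Z).

Lemma n_points_lawT n : n_points_law n setT = ((fine (mu setT)) ^+ n)%:E.
Proof.
have muE : mu setT = (fine (mu setT))%:E by rewrite fineK// fin_num_measure.
elim: n => [|n IH] /=; first by rewrite diracT expr0.
rewrite -[LHS]/(add_random_point (n_points_law n) setT) add_random_pointT.
by rewrite [X in (_ * X)%E]IH muE -EFinM exprS.
Qed.


Let L : R := fine (mu setT).

Lemma poisson_weight_ge0 n : 0 <= expR (- L) / n`!%:R :> R.
Proof. by rewrite divr_ge0 ?expR_ge0. Qed.

(** Conditionally on its number n of points, of Poisson law with mean the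
    total mass, the process consists of n independent points; the factors
    (mu setT) ^ n of that description are already in n_points_law n. *)
Definition poisson_process : set (config Z) -> \bar R :=
  mseries (fun n => mscale (NngNum (poisson_weight_ge0 n)) (n_points_law n)) 0.

HB.instance Definition _ := Measure.on poisson_process.

Lemma ge0_integral_poisson_process (f : config Z -> \bar R) :
  measurable_fun setT f -> (forall w, 0 <= f w)%E ->
  (\int[poisson_process]_w f w =
   \sum_(0 <= n <oo) ((expR (- L) / n`!%:R)%:E * \int[n_points_law n]_w f w))%E.
Proof.
move=> mf f0; rewrite /poisson_process ge0_integral_measure_series//.
by apply: eq_eseriesr => n _; rewrite ge0_integral_mscale.
Qed.

Lemma nneseries_exp (x : R) : 0 <= x ->
  (\sum_(0 <= n <oo) (x ^+ n / n`!%:R)%:E = (expR x)%:E)%E.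
Proof.
move=> x0; rewrite expRE -EFin_lim; last first.
  rewrite /pseries/=; under eq_fun do rewrite mulrC.
  exact: is_cvg_series_exp_coeff.
apply/congr_lim/funext => n/=; rewrite /pseries/= /series/= -sumEFin//.
by under eq_bigr do rewrite mulrC.
Qed.

Lemma poisson_processE A : poisson_process A =
  (\sum_(0 <= n <oo) ((expR (- L) / n`!%:R)%:E * n_points_law n A))%E.
Proof. by []. Qed.

Lemma poisson_series (x : R) : 0 <= x ->
  (\sum_(0 <= n <oo) ((expR (- L) / n`!%:R)%:E * (x ^+ n)%:E) =
   (expR (- L) * expR x)%:E)%E.
Proof.
move=> x0; rewrite EFinM -(nneseries_exp x0) -nneseriesZl; last first.
  by move=> n _; rewrite lee_fin divr_ge0 ?exprn_ge0.
by apply: eq_eseriesr => n _; rewrite -!EFinM; congr EFin; lra.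
Qed.

Let poisson_process_setT : poisson_process setT = 1%E.
Proof.
rewrite poisson_processE; under eq_eseriesr do rewrite n_points_lawT.
rewrite poisson_series; last exact: fine_ge0.
by rewrite -expRD addNr expR0.
Qed.

HB.instance Definition _ := Measure_isProbability.Build _ _ _ poisson_process
  poisson_process_setT.

Lemma poisson_process_nil : (0 < poisson_process [set [::]])%E.
Proof.
apply: (@lt_le_trans _ _ (expR (- L))%:E); first by rewrite lte_fin expR_gt0.
rewrite poisson_processE; apply: le_trans; last first.
  apply: (@nneseries_lim_ge _ _ xpredT 0 1) => n _ _.
  by rewrite mule_ge0 ?lee_fin ?poisson_weight_ge0.
rewrite big_nat1 fact0 divr1 /= diracE mem_set// mule1 //.
Qed.

Lemma measurable_fun_size : measurable_fun [set: config Z] (fun w : config Z => size w).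
Proof.
have -> : size = npoints (@setT Z).
  apply/funext => w; rewrite -count_predT; apply: eq_count => z /=.
  exact/esym/asboolT.
exact: measurable_fun_npoints.
Qed.

Lemma integral_exp_size (C : R) : 0 <= C ->
  (\int[poisson_process]_w (C ^+ size w)%:E =
   (expR (- L) * expR (C * L))%:E)%E.
Proof.
move=> C0; have mC : measurable_fun [set: config Z] (fun w : config Z => (C ^+ size w)%:E).
  have mE : measurable_fun [set: nat] (fun k : nat => (C ^+ k)%:E) by [].
  exact: (measurableT_comp mE measurable_fun_size).
have C0' w : (0 <= (C ^+ size w)%:E)%E by rewrite lee_fin exprn_ge0.
rewrite ge0_integral_poisson_process//.
rewrite -poisson_series; last by rewrite mulr_ge0 ?fine_ge0.
apply: eq_eseriesr => n _; congr (_ * _)%E.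
elim: n => [|n IH] /=.
  by rewrite integral_dirac// diracT mul1e !expr0.
rewrite ge0_integral_add_random_point//.
under eq_integral do under eq_integral do rewrite /= exprS EFinM.
under eq_integral do rewrite ge0_integralZl// ?lee_fin// IH -EFinM.
rewrite integral_cst// -[X in (_ * X)%E]fineK ?fin_num_measure// -EFinM.
by congr EFin; rewrite !exprS /L; ring.
Qed.

End add_random_point.
(** * Mecke formula and joint law of the counts *)

Section mecke.
Context {d : measure_display} {Z : measurableType d} {R : realType}.
Variable mu : {finite_measure set Z -> \bar R}.
Context {I : finType}.
Variable c : Z -> I.
Hypothesis mc : forall i, measurable (c @^-1` [set i]).
Implicit Types (h : {ffun I -> nat} -> \bar R).

Definition cell_mass (i : I) : R := fine (mu (c @^-1` [set i])).
Local Notation a := cell_mass.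

Lemma cell_mass_ge0 i : 0 <= a i. Proof. exact: fine_ge0. Qed.

Lemma incrC i j (v : {ffun I -> nat}) : incr i (incr j v) = incr j (incr i v).
Proof. by apply/ffunP => k; rewrite !ffunE addnCA. Qed.

Lemma integral_cells (g : I -> \bar R) : (forall i, 0 <= g i)%E ->
  (\int[mu]_z g (c z) = \sum_i (a i)%:E * g i)%E.
Proof.
move=> g0.
have mi i : measurable_fun [set: Z] (fun z => (\1_(c @^-1` [set i]) z)%:E : \bar R).
  by apply/measurable_EFinP; exact: measurable_indic.
rewrite (eq_integral (fun z => \sum_i g i * (\1_(c @^-1` [set i]) z)%:E)%E).
  rewrite ge0_integral_sum//=.
  - apply: eq_bigr => i _; rewrite ge0_integralZl//.
      by rewrite integral_indic// setIT muleC /cell_mass fineK// fin_num_measure.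
  - by move=> i; apply: measurable_funeM.
  - by move=> i z _; rewrite mule_ge0// lee_fin.
move=> z _; rewrite (bigD1 (c z))//= indicE mem_set// mule1 big1 ?adde0//.
move=> i icz; rewrite indicE memNset ?mule0//.
by move/esym; exact/eqP.
Qed.

Lemma integral_n_points_lawS n h : (forall v, 0 <= h v)%E ->
  (\int[n_points_law mu n.+1]_w h (counts c w) =
   \sum_i (a i)%:E * \int[n_points_law mu n]_w h (incr i (counts c w)))%E.
Proof.
move=> h0 /=; rewrite ge0_integral_add_random_point//; last first.
  exact: measurable_fun_counts.
under eq_integral do under eq_integral do rewrite counts_cons.
pose g i := (\int[n_points_law mu n]_w h (incr i (counts c w)))%E.
rewrite -(@integral_cells g)// => i.
exact: integral_ge0.
Qed.

(** The point added last either lies in cell i, which gives one copy of the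
    right-hand side integral, or is one of the points on which h depends; then
    the induction hypothesis for the remaining points gives n more copies. *)
Lemma mecke_n_points i n h : (forall v, 0 <= h v)%E ->
  (\int[n_points_law mu n.+1]_w ((counts c w i)%:R%:E * h (counts c w)) =
   (n.+1%:R * a i)%:E * \int[n_points_law mu n]_w h (incr i (counts c w)))%E.
Proof.
elim: n h => [|n IH] h h0;
  rewrite (@integral_n_points_lawS _ (fun v => ((v i)%:R%:E * h v)%E));
  try by move=> v; rewrite mule_ge0 ?lee_fin.
  rewrite (bigD1 i)//= big1 ?adde0 ?mul1r; last first.
    move=> j ji; rewrite integral_dirac//; last first.
      exact: (measurable_fun_counts mc
                (fun v => ((incr j v i)%:R%:E * h (incr j v))%E)).
    by rewrite !ffunE (negbTE ji) /= !(mul0e, mule0).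
  rewrite !integral_dirac//; first by rewrite !ffunE eqxx /= mul1e.
    exact: (measurable_fun_counts mc (fun v => h (incr i v))).
  exact: (measurable_fun_counts mc
                (fun v => ((incr i v i)%:R%:E * h (incr i v))%E)).
transitivity (\sum_j (a j)%:E * ((j == i)%:R%:E *
      (\int[n_points_law mu n.+1]_w h (incr j (counts c w))) +
    (n.+1%:R * a i)%:E *
      \int[n_points_law mu n]_w h (incr j (incr i (counts c w)))))%E.
  apply: eq_bigr => j _; congr (_ * _)%E.
  rewrite -(IH (fun v => h (incr j v)))//.
  rewrite -ge0_integralZl ?lee_fin//; last first.
    exact: (measurable_fun_counts mc (fun v => h (incr j v))).
  rewrite -ge0_integralD//=.
  - by apply: eq_integral => w _; rewrite !ffunE natrD EFinD ge0_muleDl ?lee_fin.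
  - by move=> w _; rewrite mule_ge0 ?lee_fin.
  - exact: (measurable_fun_counts mc
                (fun v => ((j == i)%:R%:E * h (incr j v))%E)).
  - by move=> w _; rewrite mule_ge0 ?lee_fin.
  - exact: (measurable_fun_counts mc
                (fun v => ((v i)%:R%:E * h (incr j v))%E)).
have i0 j : (0 <= \int[n_points_law mu n.+1]_w h (incr j (counts c w)))%E.
  exact: integral_ge0.
have i0' j : (0 <= \int[n_points_law mu n]_w h (incr j (incr i (counts c w))))%E.
  exact: integral_ge0.
have n0 : 0 <= n.+1%:R * a i by rewrite mulr_ge0 ?cell_mass_ge0.
under eq_bigr => j _ do rewrite ge0_muleDr ?mule_ge0 ?lee_fin//.
rewrite big_split /= (bigD1 i)//= eqxx mul1e big1 ?adde0; last first.
  by move=> j ji; rewrite (negbTE ji) mul0e mule0.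
under eq_bigr => j _ do rewrite muleCA.
rewrite -ge0_sume_distrr; last first.
  by move=> j _; rewrite mule_ge0 ?lee_fin ?cell_mass_ge0.
rewrite -[X in (_ + _ * X)%E]/(\sum_j _)%E.
under [X in (_ + _ * X)%E]eq_bigr => j _.
  under eq_integral do rewrite incrC.
  over.
rewrite -(@integral_n_points_lawS n (fun v => h (incr i v)))//.
rewrite -ge0_muleDl ?lee_fin ?cell_mass_ge0//; congr (_ * _)%E.
by rewrite -EFinD -[in RHS]natr1; congr EFin; ring.
Qed.

(** Mecke formula: summing the formulas for n points, the factor n.+1 shifts
    the Poisson weights by one. *)
Lemma mecke i h : (forall v, 0 <= h v)%E ->
  (\int[poisson_process mu]_w ((counts c w i)%:R%:E * h (counts c w)) =
   (a i)%:E * \int[poisson_process mu]_w h (incr i (counts c w)))%E.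
Proof.
move=> h0.
have h0' (v : {ffun I -> nat}) : (0 <= ((v i)%:R%:E * h v))%E by rewrite mule_ge0 ?lee_fin.
rewrite !ge0_integral_poisson_process//; last 2 first.
- exact: (measurable_fun_counts mc (fun v => h (incr i v))).
- exact: (measurable_fun_counts mc (fun v => ((v i)%:R%:E * h v)%E)).
rewrite -nneseriesZl; last first.
  move=> n _; rewrite mule_ge0 ?lee_fin ?poisson_weight_ge0//.
  exact: integral_ge0.
rewrite nneseries_recl//=; last first.
  move=> n _; rewrite mule_ge0 ?lee_fin ?poisson_weight_ge0//.
  by apply: integral_ge0 => w _.
rewrite integral_dirac//; last first.
  exact: (measurable_fun_counts mc (fun v => ((v i)%:R%:E * h v)%E)).
rewrite ffunE !(mul0e, mule0) add0e.
rewrite -[in LHS](@nneseries_addn _ _ 1); last first.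
  move=> n; rewrite mule_ge0 ?lee_fin ?poisson_weight_ge0//.
  by apply: integral_ge0 => w _.
apply: eq_eseriesr => n _; rewrite addn1 mecke_n_points// !muleA.
congr (_ * _)%E; rewrite -!EFinM; congr EFin.
rewrite factS natrM; field.
by rewrite nat1r !pnatr_eq0 -lt0n fact_gt0.
Qed.

End mecke.
Section joint_law.
Context {d : measure_display} {Z : measurableType d} {R : realType}.
Variable mu : {finite_measure set Z -> \bar R}.
Context {I : finType}.
Variable c : Z -> I.
Hypothesis mc : forall i, measurable (c @^-1` [set i]).
Local Notation a := (cell_mass mu c).
Local Notation P := (poisson_process mu).

Lemma sum_cell_mass : \sum_i a i = fine (mu setT).
Proof.
apply: EFin_inj; rewrite fineK ?fin_num_measure// -[RHS]mul1e -integral_cst//.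
rewrite (integral_cells mu mc (g := fun=> 1%E))// -sumEFin.
by apply: eq_bigr => i _; rewrite mule1.
Qed.

(** The formula includes the degenerate law at r = 0, where 0 ^ 0 = 1. *)
Lemma poisson_probE (r : R) k : 0 <= r ->
  poisson_prob r 0 [set k] = (r ^+ k / k`!%:R * expR (- r))%:E.
Proof.
rewrite le_eqVlt => /predU1P[<-|r0]; rewrite /poisson_prob.
  rewrite ltxx diracE oppr0 expR0 mulr1; congr EFin.
  case: k => [|k]; first by rewrite mem_set// fact0 divr1.
  by rewrite memNset// exprS mul0r mul0r.
by rewrite r0 esum_set1 /poisson_pmf r0// lee_fin !mulr_ge0 ?expR_ge0// exprn_ge0// ltW.
Qed.

Lemma incr_inj i : injective (@incr I i).
Proof.
by move=> u v /ffunP uv; apply/ffunP => j; move: (uv j); rewrite !ffunE => /addnI.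
Qed.

Let P_indic (S : set {ffun I -> nat}) :
  P [set w | S (counts c w)] = (\int[P]_w (\1_S (counts c w))%:E)%E.
Proof.
have mS := measurable_counts mc S.
transitivity (\int[P]_w (\1_(counts c @^-1` S : set (config Z)) w)%:E)%E => //.
by rewrite integral_indic// setIT.
Qed.

(** The Mecke formula for the indicator function of v is a recursion,
    v i * P (counts = v) = a i * P (counts = v with one point less in cell i);
    it determines the probabilities from that of the empty configuration. *)
Lemma poisson_process_counts_eq (v : {ffun I -> nat}) :
  P [set w | counts c w = v] = (\prod_i poisson_prob (a i) 0 [set v i])%E.
Proof.
under eq_bigr => i _ do rewrite poisson_probE ?cell_mass_ge0//.
rewrite prodEFin; move: {2}(\sum_i v i)%N (erefl (\sum_i v i)%N) => n.
elim: n v => [|n IH] v vn.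
  have v0 i : v i = 0%N.
    by move/eqP: vn; rewrite sum_nat_eq0 => /forallP/(_ i)/eqP.
  under eq_bigr => i _ do rewrite v0 expr0 fact0 divr1 mul1r.
  rewrite -expR_sum sumrN sum_cell_mass.
  rewrite poisson_processE nneseries_recl//; last first.
    by move=> k _; rewrite mule_ge0 ?lee_fin ?poisson_weight_ge0.
  rewrite fact0 divr1 /= diracE mem_set /= ?mule1; last first.
    by apply/ffunP => i; rewrite v0 counts_nil ffunE.
  rewrite eseries0 ?adde0// => -[//|k] _ _ /=.
  rewrite [X in (_ * X)%E](_ : _ = 0%E) ?mule0//.
  rewrite -[LHS]/(add_random_point mu _ _) /add_random_point /pushforward.
  transitivity ((mu \x n_points_law mu k)%E set0); last exact: measure0.
  congr (_ _).
  apply/seteqP; split => // -[z w] /= wv.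
  by move/ffunP/(_ (c z)): wv; rewrite counts_cons v0 !ffunE eqxx.
have [i vi] : exists i, (0 < v i)%N.
  have [i vi|v0] := pickP (fun i => 0 < v i)%N; first by exists i.
  by move: vn; rewrite big1// => i _; move: (v0 i); case: (v i).
pose u : {ffun I -> nat} := [ffun j => v j - (i == j)]%N.
have vu : v = incr i u.
  apply/ffunP => j; rewrite !ffunE subnKC//.
  by case: eqP => [<-|].
have un : (\sum_i u i)%N = n.
  apply: succn_inj; rewrite -vn vu.
  under [RHS]eq_bigr do rewrite ffunE.
  rewrite big_split/= [X in (_ = X + _)%N](bigD1 i)//= eqxx.
  rewrite [X in (_ = _ + X + _)%N]big1// => k ki.
  by rewrite eq_sym (negbTE ki).
pose h x : \bar R := (\1_[set v] x)%:E.
have h0 x : (0 <= h x)%E by rewrite lee_fin.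
have := @mecke _ _ _ mu _ _ mc i h h0.
rewrite (eq_integral (fun w : config Z => (v i)%:R%:E * h (counts c w))%E); last first.
  move=> w _; rewrite /h indicE; case: (boolP (_ \in _)) => [|_].
    by rewrite inE /= => ->.
  by rewrite !mule0.
rewrite [X in _ = (_ * X)%E](eq_integral
  (fun w : config Z => (\1_[set u] (counts c w))%:E)); last first.
  move=> w _; rewrite /h !indicE vu; congr (_%:R%:E); congr (nat_of_bool _).
  apply/idP/idP => /set_mem /= uw; apply/mem_set => /=.
    exact: incr_inj uw.
  by rewrite uw.
rewrite ge0_integralZl ?lee_fin//; last exact: (measurable_fun_counts mc h).
rewrite /h -!P_indic.
rewrite [X in _ = (_ * X)%E](IH u un) -[P [set w | _]]/(P [set w | counts c w = v]) -EFinM.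
have vi0 : (v i)%:R != 0 :> R by rewrite pnatr_eq0 -lt0n.
move=> /(congr1 (fun x => (v i)%:R^-1%:E * x)%E).
rewrite muleA -EFinM mulVf// mul1e => ->; rewrite -EFinM; congr EFin.
rewrite (bigD1 i)//= [in RHS](bigD1 i)//=.
rewrite (eq_bigr (fun j => a j ^+ v j / (v j)`!%:R * expR (- a j))); last first.
  by move=> j ji; rewrite ffunE eq_sym (negbTE ji) subn0.
rewrite ffunE eqxx; move: vi0 vi; case: (v i) => // k k0 _.
rewrite subn1 /= exprS factS natrM; field.
by rewrite pnatr_eq0 -lt0n fact_gt0 nat1r k0.
Qed.

(** From singletons to arbitrary sets of counts by countable additivity, one
    cell at a time: J lists the cells whose set is arbitrary. *)
Lemma poisson_process_counts (K : I -> set nat) :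
  P [set w | forall i, K i (counts c w i)] =
  (\prod_i poisson_prob (a i) 0 (K i))%E.
Proof.
suff H (J : seq I) : forall K : I -> set nat,
    (forall i, i \notin J -> exists k, K i = [set k]) ->
    P [set w | forall i, K i (counts c w i)] =
    (\prod_i poisson_prob (a i) 0 (K i))%E.
  by apply: (H (enum I)) => i; rewrite mem_enum.
elim: J => [|j J IH] {}K KJ.
  have [v vK] : exists v : {ffun I -> nat}, forall i, K i = [set v i].
    have /choice[f fP] : forall i, exists k, K i = [set k] by move=> i; exact: KJ.
    by exists (finfun f) => i; rewrite ffunE.
  under eq_bigr => i _ do rewrite vK.
  rewrite -poisson_process_counts_eq; congr (P _).
  apply/seteqP; split => [w /= wK|w /= wv i]; last by rewrite vK wv.
  by apply/ffunP => i; have := wK i; rewrite vK.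
pose K' k i := if i == j then [set k] else K i.
pose C := (\prod_(i | i != j) poisson_prob (a i) 0 (K i))%E.
have Kj B : (\prod_i poisson_prob (a i) 0 (if i == j then B else K i) =
             C * poisson_prob (a j) 0 B)%E.
  rewrite (bigD1 j)//= eqxx muleC; congr (_ * _)%E.
  by apply: eq_bigr => i /negbTE ->.
transitivity (C * poisson_prob (a j) 0 (K j))%E; last first.
  by rewrite -Kj; apply: eq_bigr => i _; case: eqP => // ->.
have {}IH k : P [set w | forall i, K' k i (counts c w i)] =
    (C * poisson_prob (a j) 0 [set k])%E.
  rewrite -Kj IH// => i iJ; rewrite /K'; case: eqP => [_|/eqP ij].
    by exists k.
  by apply: KJ; rewrite inE negb_or ij.
rewrite [X in P X](_ : _ = \bigcup_(k in K j)
    [set w | forall i, K' k i (counts c w i)]); last first.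
  apply/seteqP; split => [w /= wK|w [k Kk wK] i].
    exists (counts c w j) => // i; rewrite /K'; case: eqP => [->//|_].
    exact: wK.
  by move: (wK i); rewrite /K'; case: eqP => // -> /= ->.
rewrite measure_bigcup; last 2 first.
- move=> k _; exact: (measurable_counts mc (fun v => forall i, K' k i (v i))).
- apply/trivIsetP => k l _ _ kl; apply/seteqP; split => // w [/(_ j) + /(_ j)].
  by rewrite /K' eqxx /= => -> /eqP; rewrite (negbTE kl).
rewrite [X in (_ * poisson_prob _ _ X)%E](_ : _ = \bigcup_(k in K j) [set k]); last first.
  by apply/seteqP; split => [k Kk|k [l Kl ->]//]; exists k.
rewrite measure_bigcup//; last first.
  apply/trivIsetP => k l _ _ kl; apply/seteqP; split => // m [/= -> /eqP].
  by rewrite (negbTE kl).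
have Cf : C \is a fin_num.
  by apply: prode_fin_num => i _; exact: fin_num_measure.
rewrite -(fineK Cf) -nneseriesZl//.
by apply: eq_eseriesr => k _; rewrite fineK; [exact: IH|].
Qed.

End joint_law.
Section disjoint_family.
Context {d : measure_display} {Z : measurableType d}.
Variables (n : nat) (A : 'I_n -> set Z).
Hypothesis mA : forall i, measurable (A i).
Hypothesis tA : trivIset setT A.

(** The value None marks the complement of the family, which makes it a
    partition of the whole space. *)
Definition member_index (z : Z) : option 'I_n := [pick i | `[< A i z >]].

Lemma member_index_Some i : member_index @^-1` [set Some i] = A i.
Proof.
apply/seteqP; split => z; rewrite /preimage /= /member_index.
  by case: pickP => // j /asboolP Ajz [<-].
case: pickP => [j /asboolP Ajz Aiz|/(_ i) /asboolP//].
by congr Some; apply: (tA (i := j) (j := i)) => //; exists z.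
Qed.

Lemma measurable_member_index i : measurable (member_index @^-1` [set i]).
Proof.
case: i => [i|]; first by rewrite member_index_Some.
rewrite [X in measurable X](_ : _ = \bigcap_(i in [set: 'I_n]) ~` A i).
  apply: fin_bigcap_measurable; first exact: finite_finset.
  by move=> i _; exact: measurableC.
apply/seteqP; split => z; rewrite /preimage /= /member_index.
  by case: pickP => // Az _ i _ Aiz; move: (Az i) => /asboolP.
by case: pickP => // i /asboolP Aiz /(_ i I).
Qed.

Lemma counts_member_index w i :
  counts member_index w (Some i) = npoints (A i) w.
Proof. by rewrite counts_npoints member_index_Some. Qed.

End disjoint_family.

Section poisson_random_measure.
Context {d : measure_display} {Z : measurableType d} {R : realType}.
Variable mu : {finite_measure set Z -> \bar R}.
Local Notation P := (poisson_process mu).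

Lemma poisson_process_npoints n (A : 'I_n -> set Z) (K : 'I_n -> set nat) :
  (forall i, measurable (A i)) -> trivIset setT A ->
  P [set w | forall i, K i (npoints (A i) w)] =
  (\prod_i poisson_prob (fine (mu (A i))) 0 (K i))%E.
Proof.
move=> mA tA.
pose K' (o : option 'I_n) := if o is Some i then K i else setT.
transitivity (P [set w | forall o, K' o (counts (member_index A) w o)]).
  congr (P _); apply/seteqP; split => [w /= wK [i|]//=|w /= wK i].
    by rewrite counts_member_index.
  by have := wK (Some i); rewrite /= counts_member_index.
rewrite poisson_process_counts; last exact: measurable_member_index.
rewrite (bigD1 None)//= probability_setT mul1e.
rewrite (reindex_omap Some id)//=; last by case.
apply: eq_big => [i|i _]; first by rewrite eqxx.
by rewrite /cell_mass member_index_Some.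
Qed.

Lemma poisson_process_npoints1 (A : set Z) (K : set nat) : measurable A ->
  P [set w | K (npoints A w)] = poisson_prob (fine (mu A)) 0 K.
Proof.
move=> mA.
have := @poisson_process_npoints 1 (fun=> A) (fun=> K) (fun=> mA).
rewrite big_ord_recl big_ord0 mule1 => <-; last first.
  by move=> i j _ _ _; rewrite !ord1.
by congr (P _); apply/seteqP; split => [w //=|w /= /(_ ord0)].
Qed.

Lemma poisson_process_is_prm :
  poisson_random_measure P mu (points_kernel Z R).
Proof.
split.
- split=> [w|w A mA]; last by right; exists (npoints A w); rewrite points_kernelE.
  apply: fin_num_fun_sigma_finite; first by rewrite measure0.
  by move=> A mA; rewrite points_kernelE.
- move=> A mA _ k; rewrite -(poisson_process_npoints1 _ mA).
  congr (P _); apply/seteqP; split => w /=; rewrite points_kernelE.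
    by case=> /eqP; rewrite eqr_nat => /eqP.
  by move=> ->.
- move=> A mA muA; have : mu A \is a fin_num by exact: fin_num_measure.
  by rewrite muA.
- move=> n A mA tA B mB.
  pose K i : set nat := [set k | B i k%:R%:E].
  transitivity (P [set w | forall i, K i (npoints (A i) w)]).
    congr (P _); apply/seteqP; split => w /= wB i; move: (wB i);
    by rewrite points_kernelE.
  rewrite poisson_process_npoints//; apply: eq_bigr => i _.
  rewrite -poisson_process_npoints1//; congr (P _).
  by apply/seteqP; split => w; rewrite /preimage /= points_kernelE.
Qed.

End poisson_random_measure.
(** * Moments of polynomials in the compensated counts *)

Section moments.
Context {d : measure_display} {Z : measurableType d} {R : realType}.
Variable mu : {finite_measure set Z -> \bar R}.
Context {I : finType}.
Variable c : Z -> I.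
Hypothesis mc : forall i, measurable (c @^-1` [set i]).
Local Notation a := (cell_mass mu c).
Local Notation P := (poisson_process mu).
Local Notation V := {ffun I -> nat}.
Implicit Types (h : V -> R) (v : V).

(** This class contains the polynomials in the counts, is closed under the
    operations below, and consists of integrable functions, since the total
    number of points has exponential moments. *)
Definition exp_bounded h : Prop :=
  exists2 C, 1 <= C & forall v, `|h v| <= C ^+ (\sum_i v i).+1.

Lemma exp_boundedD h h' :
  exp_bounded h -> exp_bounded h' -> exp_bounded (fun v => h v + h' v).
Proof.
move=> [C C1 hC] [D D1 hD]; exists (C + D) => [|v]; first lra.
apply: (le_trans (ler_normD _ _)); apply: (le_trans (lerD (hC v) (hD v))).
have C0 : 0 <= C by lra. have D0 : 0 <= D by lra.
rewrite [leRHS]exprS mulrDl; apply: lerD; rewrite exprS ler_wpM2l//;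
  by rewrite lerXn2r ?nnegrE; lra.
Qed.

Lemma exp_boundedM h h' :
  exp_bounded h -> exp_bounded h' -> exp_bounded (fun v => h v * h' v).
Proof.
move=> [C C1 hC] [D D1 hD]; exists (C * D) => [|v].
  by rewrite mulr_ege1.
by rewrite normrM exprMn ler_pM.
Qed.

Lemma exp_bounded_cst r : exp_bounded (fun=> r).
Proof.
exists (1 + `|r|) => [|v]; first by rewrite lerDl.
apply: (@le_trans _ _ (1 + `|r|)); first lra.
by rewrite exprS ler_peMr ?exprn_ege1 ?addr_ge0// lerDl.
Qed.

Lemma exp_boundedX h k : exp_bounded h -> exp_bounded (fun v => h v ^+ k).
Proof.
move=> hb; elim: k => [|k IH]; first exact: exp_bounded_cst.
under eq_fun do rewrite exprS; exact: exp_boundedM.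
Qed.

Lemma exp_bounded_sum (J : Type) (s : seq J) (f : J -> V -> R) :
  (forall j, exp_bounded (f j)) -> exp_bounded (fun v => \sum_(j <- s) f j v).
Proof.
move=> fb; elim: s => [|j s IH].
  by under eq_fun do rewrite big_nil; exact: exp_bounded_cst.
by under eq_fun do rewrite big_cons; exact: exp_boundedD.
Qed.

Lemma exp_bounded_count i : exp_bounded (fun v => (v i)%:R).
Proof.
exists 2 => [|v]; first by rewrite ler1n.
rewrite ger0_norm//; apply: (@le_trans _ _ (\sum_i v i)%:R).
  by rewrite ler_nat (bigD1 i)//= leq_addr.
rewrite -natrX ler_nat; apply: leq_trans (leqnSn _) _.
exact: ltnW (ltn_expl _ _).
Qed.

Lemma exp_bounded_incr i h : exp_bounded h -> exp_bounded (fun v => h (incr i v)).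
Proof.
move=> [C C1 hC]; have C0 : 0 <= C by lra.
exists (C ^+ 2) => [|v]; first by rewrite exprn_ege1.
apply: (le_trans (hC _)); rewrite -exprM ler_weXn2l//.
suff -> : (\sum_j incr i v j = (\sum_j v j).+1)%N.
  by rewrite mul2n -addnn addSn addnS !ltnS leq_addl.
under eq_bigr do rewrite ffunE.
rewrite big_split/= [X in (X + _)%N](bigD1 i)//= eqxx [X in (_ + X + _)%N]big1//.
by move=> k ki; rewrite eq_sym (negbTE ki).
Qed.

Lemma sum_counts w : (\sum_i counts c w i)%N = size w.
Proof.
elim: w => [|z w IH]; first by rewrite counts_nil big1// => i _; rewrite ffunE.
rewrite counts_cons; under eq_bigr do rewrite ffunE.
rewrite big_split/= IH (bigD1 (c z))//= eqxx big1//.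
by move=> k ki; rewrite eq_sym (negbTE ki).
Qed.

Lemma integrable_counts h : exp_bounded h ->
  P.-integrable setT (fun w => (h (counts c w))%:E).
Proof.
move=> [C C1 hC]; have C0 : 0 <= C by lra.
apply: (le_integrable _ (g := fun w : config Z => (C ^+ (size w).+1)%:E)) => //.
- exact: (measurable_fun_counts mc (fun v => (h v)%:E)).
- move=> w _ /=; rewrite lee_fin (ger0_norm (exprn_ge0 _ C0)).
  by rewrite -sum_counts.
- have mC : measurable_fun [set: config Z] (fun w : config Z => (C ^+ size w)%:E).
    have mE : measurable_fun [set: nat] (fun k : nat => (C ^+ k)%:E) by [].
    exact: (measurableT_comp mE measurable_fun_size).
  under eq_fun do rewrite exprS EFinM.
  apply/integrableP; split; first exact: measurable_funeM.
  under eq_integral do rewrite abseM !abse_EFin !ger0_norm ?exprn_ge0//.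
  rewrite ge0_integralZl ?lee_fin// => [|w _]; last by rewrite lee_fin exprn_ge0.
  by rewrite integral_exp_size// -EFinM ltry.
Qed.

Definition mean h : R := \int[P]_w h (counts c w).

Lemma mean_expectation h : exp_bounded h ->
  'E_P[fun w => h (counts c w)]%E = (mean h)%:E.
Proof.
move=> hb; rewrite expectation.unlock /mean /Rintegral fineK//.
exact/integrable_fin_num/integrable_counts.
Qed.

Lemma meanD h h' : exp_bounded h -> exp_bounded h' ->
  mean (fun v => h v + h' v) = mean h + mean h'.
Proof.
by move=> hb hb'; rewrite /mean RintegralD//; exact: integrable_counts.
Qed.

Lemma meanZ r h : exp_bounded h -> mean (fun v => r * h v) = r * mean h.
Proof.
by move=> hb; rewrite /mean RintegralZl//; exact: integrable_counts.
Qed.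

Lemma mean_cst r : mean (fun=> r) = r.
Proof.
rewrite /mean Rintegral_cst// [X in fine X](_ : _ = 1%E) ?mulr1//.
exact: probability_setT.
Qed.

Lemma meanB h h' : exp_bounded h -> exp_bounded h' ->
  mean (fun v => h v - h' v) = mean h - mean h'.
Proof.
by move=> hb hb'; rewrite /mean RintegralB//; exact: integrable_counts.
Qed.

Lemma mean_mecke i h : exp_bounded h ->
  mean (fun v => (v i)%:R * h v) = a i * mean (fun v => h (incr i v)).
Proof.
have pos h' : (forall v, 0 <= h' v) -> exp_bounded h' ->
    mean (fun v => (v i)%:R * h' v) = a i * mean (fun v => h' (incr i v)).
  move=> h0 hb; apply: EFin_inj; rewrite EFinM -!mean_expectation//; last 2 first.
  - exact: exp_bounded_incr.
  - by apply: exp_boundedM => //; exact: exp_bounded_count.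
  rewrite expectation.unlock.
  by rewrite -(@mecke _ _ _ mu _ _ mc i (fun v => (h' v)%:E)).
(* A bound K of h makes h + K and K nonnegative. *)
move=> hb; have [C C1 hC] := hb; have C0 : 0 <= C by lra.
pose K v := C ^+ (\sum_i v i).+1.
have K0 v : 0 <= K v by rewrite exprn_ge0.
have Kb : exp_bounded K by exists C => // v; rewrite ger0_norm.
have hK0 v : 0 <= h v + K v.
  by have := hC v; rewrite ler_norml => /andP[]; rewrite /K; lra.
have nb := exp_bounded_count i.
have nhb := exp_boundedM nb hb; have nKb := exp_boundedM nb Kb.
have : mean (fun v => (v i)%:R * h v) + mean (fun v => (v i)%:R * K v) =
    a i * (mean (fun v => h (incr i v)) + mean (fun v => K (incr i v))).
  rewrite -meanD// -meanD; [|exact: exp_bounded_incr..].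
  rewrite -(pos _ hK0 (exp_boundedD hb Kb)); congr mean; apply/funext => v.
  by rewrite mulrDr.
by rewrite (pos K)// mulrDr => /addIr.
Qed.

Definition compensated_count i v : R := (v i)%:R - a i.
Local Notation X := compensated_count.

Lemma exp_bounded_X i : exp_bounded (X i).
Proof.
apply: exp_boundedD; first exact: exp_bounded_count.
exact: exp_bounded_cst.
Qed.

Lemma X_incr i v : X i (incr i v) = X i v + 1.
Proof. by rewrite /X ffunE eqxx /= add1n -natr1; ring. Qed.

Lemma X_incr_neq i j v : i != j -> X i (incr j v) = X i v.
Proof. by move=> ij; rewrite /X ffunE eq_sym (negbTE ij). Qed.

(** Integration by parts: the compensated count is dual to the difference
    operator in its coordinate. *)
Lemma mean_X i h : exp_bounded h ->
  mean (fun v => X i v * h v) = a i * mean (fun v => h (incr i v) - h v).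
Proof.
move=> hb; have hib := exp_bounded_incr i hb.
rewrite meanB// mulrBr -mean_mecke// -meanZ// -meanB.
- by congr mean; apply/funext => v; rewrite mulrBl.
- exact: exp_boundedM (exp_bounded_count i) hb.
- exact: exp_boundedM (exp_bounded_cst _) hb.
Qed.

(** Central moments of order at most 4 of the Poisson law of mean r. *)
Definition poisson_moment (k : nat) (r : R) : R :=
  nth 0 [:: 1; 0; r; r; r + 3 * r ^+ 2] k.
Local Notation m := poisson_moment.

Definition free_of i h : Prop := forall v, h (incr i v) = h v.

(** Integration by parts lowers the power: the difference of X ^ j is a
    polynomial of degree j - 1 in X. *)
Lemma mean_X_pow k i h : (k < 5)%N -> exp_bounded h -> free_of i h ->
  mean (fun v => X i v ^+ k * h v) = m k (a i) * mean h.
Proof.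
move=> k5 hb hi; have Xb := exp_bounded_X i.
have Xk j : exp_bounded (fun v => X i v ^+ j * h v).
  by apply: exp_boundedM => //; exact: exp_boundedX.
have parts j : mean (fun v => X i v ^+ j.+1 * h v) =
    a i * mean (fun v => (X i v + 1) ^+ j * h v - X i v ^+ j * h v).
  have -> : (fun v => X i v ^+ j.+1 * h v) = fun v => X i v * (X i v ^+ j * h v).
    by apply/funext => v; rewrite mulrA -exprS.
  rewrite mean_X//; congr (_ * mean _); apply/funext => v.
  by rewrite X_incr hi.
have m1 : mean (fun v => X i v * h v) = 0.
  rewrite mean_X// (_ : (fun v => _) = fun=> 0) ?mean_cst ?mulr0//.
  by apply/funext => v; rewrite hi subrr.
have m2 : mean (fun v => X i v ^+ 2 * h v) = a i * mean h.
  rewrite parts; congr (_ * mean _); apply/funext => v; ring.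
have m3 : mean (fun v => X i v ^+ 3 * h v) = a i * mean h.
  rewrite parts (_ : (fun v => _) = fun v => 2 * (X i v * h v) + h v); last first.
    by apply/funext => v; ring.
  rewrite meanD// ?meanZ ?m1 ?mulr0 ?add0r//.
  - exact: exp_boundedM.
  - by apply: exp_boundedM; [exact: exp_bounded_cst|exact: exp_boundedM].
case: k k5 => [|[|[|[|[|//]]]]] _; rewrite /m /=.
- by rewrite mul1r; congr mean; apply/funext => v; rewrite expr0 mul1r.
- by rewrite mul0r -m1.
- exact: m2.
- exact: m3.
- rewrite parts (_ : (fun v => _) =
    fun v => 3 * (X i v ^+ 2 * h v) + (3 * (X i v * h v) + h v)); last first.
    by apply/funext => v; ring.
  have b1 : exp_bounded (fun v => 3 * (X i v * h v)).
    by apply: exp_boundedM; [exact: exp_bounded_cst|exact: exp_boundedM].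
  have b2 : exp_bounded (fun v => 3 * (X i v ^+ 2 * h v)).
    by apply: exp_boundedM; first exact: exp_bounded_cst.
  rewrite meanD//; last exact: exp_boundedD.
  rewrite meanD// !meanZ//; last exact: exp_boundedM.
  by rewrite m1 m2; ring.
Qed.

End moments.
Section disjoint_products.
Context {d : measure_display} {Z : measurableType d} {R : realType}.
Variable mu : {finite_measure set Z -> \bar R}.
Context {I : finType}.
Variable c : Z -> I.
Hypothesis mc : forall i, measurable (c @^-1` [set i]).
Local Notation a := (cell_mass mu c).
Local Notation mean := (mean mu c).
Local Notation X := (compensated_count mu c).
Local Notation m := poisson_moment.
Local Notation V := {ffun I -> nat}.

Lemma mean_product_pow k i j (h : V -> R) : (k < 5)%N -> i != j ->
  exp_bounded h -> free_of i h -> free_of j h ->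
  mean (fun v => (X i v * X j v) ^+ k * h v) = m k (a i) * m k (a j) * mean h.
Proof.
move=> k5 ij hb hi hj.
have -> : (fun v => (X i v * X j v) ^+ k * h v) =
          fun v => X i v ^+ k * (X j v ^+ k * h v).
  by apply/funext => v; rewrite exprMn mulrA.
rewrite mean_X_pow//.
- by rewrite mean_X_pow// mulrA.
- by apply: exp_boundedM => //; apply: exp_boundedX; exact: exp_bounded_X.
- by move=> v; rewrite hi X_incr_neq// eq_sym.
Qed.

Variables (k l r : R).

Definition product_sum (s : seq (I * I)) (v : V) : R :=
  \sum_(p <- s) k * (X p.1 v * X p.2 v).

Lemma exp_bounded_product_sum s : exp_bounded (product_sum s).
Proof.
apply: exp_bounded_sum => p; apply: exp_boundedM; first exact: exp_bounded_cst.
by apply: exp_boundedM; exact: exp_bounded_X.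
Qed.

Lemma free_of_product_sum i s :
  i \notin unzip1 s -> i \notin unzip2 s -> free_of i (product_sum s).
Proof.
move=> i1 i2 v; apply: eq_big_seq => p ps.
by rewrite !X_incr_neq//; [apply: contraNneq i2 => <-|apply: contraNneq i1 => <-];
  apply: map_f.
Qed.

(** The summands are independent and centred, so each moment of the sum comes
    from the binomial formula by adding one summand at a time. *)
Lemma mean_product_sum_pow (s : seq (I * I)) :
  uniq (unzip1 s ++ unzip2 s) ->
  (forall p, p \in s -> a p.1 = l /\ a p.2 = r) ->
  [/\ mean (product_sum s) = 0,
      mean (fun v => product_sum s v ^+ 2) = (size s)%:R * (k ^+ 2 * (l * r)),
      mean (fun v => product_sum s v ^+ 3) = (size s)%:R * (k ^+ 3 * (l * r)) &
      mean (fun v => product_sum s v ^+ 4) =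
        (size s)%:R * (k ^+ 4 * (m 4 l * m 4 r) - 3 * (k ^+ 2 * (l * r)) ^+ 2)
        + 3 * ((size s)%:R * (k ^+ 2 * (l * r))) ^+ 2 ].
Proof.
elim: s => [|[i j] s IH] us as_.
  have z n : (fun v => product_sum [::] v ^+ n.+1) = fun=> 0.
    by apply/funext => v; rewrite /product_sum big_nil expr0n.
  rewrite -[product_sum [::]]/(fun v => product_sum [::] v ^+ 1) !z !mean_cst.
  by split => //; rewrite !(mul0r, mulr0) ?expr0n ?mulr0 ?addr0.
have {}as_ p : p \in (i, j) :: s -> a p.1 = l /\ a p.2 = r := as_ p.
have [al ar] := as_ (i, j) (mem_head _ _); rewrite /= in al ar.
move: us; rewrite /= cat_uniq /= negb_or.
rewrite mem_cat inE !negb_or => /andP[/and3P[is1 ij is2]].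
move=> /and4P[us1 /andP[js1 us12] js2 us2].
have us : uniq (unzip1 s ++ unzip2 s) by rewrite cat_uniq us1 us2 us12.
have [G1 G2 G3 G4] := IH us (fun p ps => as_ p (mem_behead (s := _ :: s) ps)).
pose G := product_sum s; pose Y v := X i v * X j v.
have Gb : exp_bounded G by exact: exp_bounded_product_sum.
have Yb : exp_bounded Y by apply: exp_boundedM; exact: exp_bounded_X.
have YG p q : (p < 5)%N ->
    mean (fun v => Y v ^+ p * G v ^+ q) = m p l * m p r * mean (fun v => G v ^+ q).
  move=> p5; rewrite mean_product_pow ?al ?ar//.
  - exact: exp_boundedX.
  - by move=> v; rewrite /G free_of_product_sum.
  - by move=> v; rewrite /G free_of_product_sum.
have YGb r' p q : exp_bounded (fun v => r' * (Y v ^+ p * G v ^+ q)).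
  apply: exp_boundedM; first exact: exp_bounded_cst.
  by apply: exp_boundedM; exact: exp_boundedX.
have YGr r' p q : (p < 5)%N -> mean (fun v => r' * (Y v ^+ p * G v ^+ q)) =
    r' * (m p l * m p r * mean (fun v => G v ^+ q)).
  move=> p5; rewrite meanZ ?YG//.
  by apply: exp_boundedM; exact: exp_boundedX.
have SE v : product_sum ((i, j) :: s) v = k * Y v + G v.
  by rewrite /product_sum big_cons.
have E0 : mean (fun v => G v ^+ 0) = 1.
  by rewrite -[RHS](mean_cst mu c) //; congr mean; apply/funext => v; rewrite expr0.
have E1 : mean (fun v => G v ^+ 1) = 0 by rewrite -G1.
split.
- rewrite (_ : product_sum _ = fun v => k * (Y v ^+ 1 * G v ^+ 0) +
     1 * (Y v ^+ 0 * G v ^+ 1)); last first.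
    by apply/funext => v; rewrite SE; ring.
  by rewrite meanD// !YGr// E0 E1 /m /=; ring.
- rewrite (_ : (fun v => _) = fun v => k ^+ 2 * (Y v ^+ 2 * G v ^+ 0) +
     (2 * k * (Y v ^+ 1 * G v ^+ 1) + 1 * (Y v ^+ 0 * G v ^+ 2))); last first.
    by apply/funext => v; rewrite SE; ring.
  rewrite meanD//; last exact: exp_boundedD.
  by rewrite meanD// !YGr// E0 E1 G2 /m /= -natr1; ring.
- rewrite (_ : (fun v => _) = fun v => k ^+ 3 * (Y v ^+ 3 * G v ^+ 0) +
     (3 * k ^+ 2 * (Y v ^+ 2 * G v ^+ 1) + (3 * k * (Y v ^+ 1 * G v ^+ 2) +
      1 * (Y v ^+ 0 * G v ^+ 3)))); last first.
    by apply/funext => v; rewrite SE; ring.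
  rewrite meanD//; last by do 2 apply: exp_boundedD => //.
  rewrite meanD//; last exact: exp_boundedD.
  by rewrite meanD// !YGr// E0 E1 G2 G3 /m /= -natr1; ring.
- rewrite (_ : (fun v => _) = fun v => k ^+ 4 * (Y v ^+ 4 * G v ^+ 0) +
     (4 * k ^+ 3 * (Y v ^+ 3 * G v ^+ 1) + (6 * k ^+ 2 * (Y v ^+ 2 * G v ^+ 2) +
     (4 * k * (Y v ^+ 1 * G v ^+ 3) + 1 * (Y v ^+ 0 * G v ^+ 4))))); last first.
    by apply/funext => v; rewrite SE; ring.
  rewrite meanD//; last by do 3 apply: exp_boundedD => //.
  rewrite meanD//; last by do 2 apply: exp_boundedD => //.
  rewrite meanD//; last exact: exp_boundedD.
  by rewrite meanD// !YGr// E0 E1 G2 G3 G4 /m /= -natr1; ring.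
Qed.

End disjoint_products.
(** * Double integrals of elementary kernels *)

Section elementary_kernel.
Context {d : measure_display} {Z : measurableType d} {R : realType}.
Variable mu : {finite_measure set Z -> \bar R}.
Variable g : elementary_kernel mu.

Lemma ek_fun_sym x y : ek_fun g (x, y) = ek_fun g (y, x).
Proof.
rewrite /ek_fun exchange_big /=; apply: eq_bigr => i _; apply: eq_bigr => j _.
by rewrite -[in LHS](ek_sym g) mxE mulrAC.
Qed.

Lemma measurable_ek_fun : measurable_fun setT (ek_fun g).
Proof.
apply: measurable_sum => i; apply: measurable_sum => j.
apply: measurable_funM; first apply: measurable_funM => //.
- have mi : measurable_fun setT (\1_(ek_set g i) : Z -> R).
    by apply: measurable_indic; exact: ek_measurable.
  exact: (measurableT_comp mi measurable_fst).
- have mj : measurable_fun setT (\1_(ek_set g j) : Z -> R).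
    by apply: measurable_indic; exact: ek_measurable.
  exact: (measurableT_comp mj measurable_snd).
Qed.

Lemma ek_fun_bounded :
  exists C, forall z, `|ek_fun g z| <= C.
Proof.
exists (\sum_i \sum_j `|ek_coef g i j|) => z.
apply: (le_trans (ler_norm_sum _ _ _)); apply: ler_sum => i _.
apply: (le_trans (ler_norm_sum _ _ _)); apply: ler_sum => j _.
rewrite !normrM -mulrA ler_piMr// mulr_ile1//;
  by rewrite indicE; case: (_ \in _); rewrite ?normr1 ?normr0.
Qed.

Lemma ek_fun_L2s : L2s mu (ek_fun g).
Proof.
split; last exact: ek_fun_sym.
have [C gC] := ek_fun_bounded.
have C0 : 0 <= C := le_trans (normr_ge0 _) (gC point).
rewrite inE/=; apply/andP; split; rewrite inE/=; first exact: measurable_ek_fun.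
rewrite /finite_norm unlock poweR_lty//=.
apply: (@le_lt_trans _ _ (\int[(mu \x mu)%E]_z (C `^ 2)%:E)%E).
  apply: ge0_le_integral => //.
  - apply/measurable_EFinP; apply: (measurableT_comp (f := fun x : R => x `^ 2)) => //.
    by apply: measurableT_comp => //; exact: measurable_ek_fun.
  - by move=> z _; rewrite lee_fin ge0_ler_powR ?nnegrE.
rewrite integral_cst//= -setXTT product_measure1E//.
by rewrite ltey_eq !fin_numM// fin_num_measure.
Qed.

Lemma second_chaos_elementary {dO : measure_display} {Omega : measurableType dO}
    (P : probability Omega R) (eta : R.-ker Omega ~> Z) (F : {RV P >-> R}) :
  (forall w, F w = ek_integral eta g w) -> second_chaos mu eta F.
Proof.
move=> FE; exists (ek_fun g); first exact: ek_fun_L2s.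
exists (fun=> g); split.
  under eq_integral do rewrite subrr expr0n.
  by rewrite integral0; exact: cvg_cst.
rewrite (_ : (fun w => _) = cst 0); first by rewrite expectation_cst; exact: cvg_cst.
by apply/funext => w; rewrite FE subrr expr0n.
Qed.

End elementary_kernel.

(** * Lebesgue measure on an interval *)

Section interval_measure.
Context {R : realType}.
Variable N : nat.

Definition interval_measure : set (measurableTypeR R) -> \bar R :=
  mrestr lebesgue_measure (measurable_itv `[0, N%:R : R[).

HB.instance Definition _ := Measure.on interval_measure.

Let interval_measure_fin : fin_num_fun interval_measure.
Proof.
apply: lty_fin_num_fun; rewrite /= /interval_measure /mrestr setTI.
by rewrite lebesgue_measure_itv/=; case: ifP => _; rewrite ltry.
Qed.

HB.instance Definition _ :=
  Measure_isFinite.Build _ _ _ interval_measure interval_measure_fin.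

(** A set of positive measure cannot be covered by the null ones among
    countably many intervals of length smaller than its measure. *)
Lemma interval_measure_atomless : atomless interval_measure.
Proof.
move=> A mA A0.
have Af : interval_measure A \is a fin_num by exact: fin_num_measure.
pose e := fine (interval_measure A) / 2.
have Ae : interval_measure A = (e + e)%:E by rewrite -[LHS]fineK//; congr EFin; rewrite /e; lra.
have e0 : 0 < e by move: A0; rewrite Ae lte_fin; lra.
pose cell (k : nat) : set (measurableTypeR R) := `[k%:R * e, k.+1%:R * e[%classic.
have mcell k : measurable (A `&` cell k).
  by apply: measurableI => //; exact: measurable_itv.
have [[k k0]|null] := pselect (exists k, (0 < interval_measure (A `&` cell k))%E).
  exists (A `&` cell k); split => //.
  apply: (@le_lt_trans _ _ e%:E); last by rewrite Ae lte_fin; lra.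
  apply: (@le_trans _ _ (lebesgue_measure (cell k))).
    apply: le_measure; rewrite ?inE //=.
    - by apply: measurableI => //; exact: measurable_itv.
    - exact: measurable_itv.
    - by move=> x [[]].
  rewrite lebesgue_measure_itv/= lte_fin ltr_pM2r// ltr_nat ltnSn.
  by rewrite -EFinB lee_fin -mulrBl -natr1 addrAC subrr add0r mul1r.
suff : (interval_measure A <= 0)%E by rewrite leNgt A0.
have cover : interval_measure A = interval_measure (\bigcup_k (A `&` cell k)).
  rewrite /interval_measure /mrestr; congr lebesgue_measure.
  apply/seteqP; split => x; last by move=> [[k _ [? _]] ?].
  move=> [Ax x0]; split => //; move: x0; rewrite /= in_itv/= => /andP[x0 _].
  exists (Num.truncn (x / e)) => //; split => //.
  rewrite /cell /= in_itv/= -ler_pdivlMr// -ltr_pdivrMr//.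
  by apply: truncn_itv; rewrite divr_ge0// ltW.
rewrite cover.
have mU : measurable (\bigcup_k (A `&` cell k)) by exact: bigcupT_measurable.
apply: (le_trans (measure_sigma_subadditive interval_measure mcell mU (@subset_refl _ _))).
rewrite eseries0// => k _ _; apply/eqP; rewrite -measure_le0 leNgt.
by apply/negP => k0; apply: null; exists k.
Qed.

Variable b : 'I_N -> R.
Hypothesis b01 : forall i, 0 < b i < 1.

Definition cell (i : 'I_N) : set (measurableTypeR R) := `[i%:R, i%:R + b i[%classic.

Lemma measurable_cell i : measurable (cell i).
Proof. exact: measurable_itv. Qed.

Lemma trivIset_cell : trivIset setT cell.
Proof.
move=> i j _ _ [x []]; rewrite /cell /= !in_itv/= => /andP[ix xi] /andP[jx xj].
have lt1 (k l : nat) (bk : R) : bk < 1 -> l%:R <= x -> x < k%:R + bk -> (l <= k)%N.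
  move=> b1 lx xk; rewrite -ltnS -(ltr_nat R) -natr1; lra.
have /andP[_ bi] := b01 i; have /andP[_ bj] := b01 j.
by apply/val_inj/eqP; rewrite eqn_leq (lt1 _ _ _ bj ix xj) (lt1 _ _ _ bi jx xi).
Qed.

Lemma interval_measure_cell i : interval_measure (cell i) = (b i)%:E.
Proof.
have /andP[b0 b1] := b01 i.
rewrite /interval_measure /mrestr setIidl; last first.
  move=> x; rewrite /cell /= !in_itv/= => /andP[ix xi].
  have iN : i%:R + 1 <= N%:R :> R by rewrite natr1 ler_nat.
  have i0 : 0 <= i%:R :> R by [].
  apply/andP; split; lra.
rewrite /cell lebesgue_measure_itv/= lte_fin ltrDl b0 -EFinB.
by rewrite addrAC subrr add0r.
Qed.

End interval_measure.
Arguments measurable_cell {R N} b i.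
Arguments trivIset_cell {R N b} _.
(** * Representatives and the add-one derivative *)

Section measure_space.
Context {d : measure_display} {Z : measurableType d} {R : realType}.

Definition evaluation_sets : set (set {measure set Z -> \bar R}) :=
  [set S | exists A (B : set (\bar R)), [/\ measurable A, measurable B &
         S = [set m : {measure set Z -> \bar R} | B (m A)] ] ].

(** A name to carry the structures below. *)
Definition measures := {measure set Z -> \bar R}.

HB.instance Definition _ := gen_eqMixin measures.
HB.instance Definition _ := gen_choiceMixin measures.
HB.instance Definition _ := isPointed.Build measures mzero.

(** The space of measures as a measurable type, so that the evaluation
    sigma-algebra can be handled by the calculus of measurable functions. *)
Definition measure_space := g_sigma_algebraType (evaluation_sets : set (set measures)).

HB.instance Definition _ := Measurable.on measure_space.

Lemma measurable_evaluation (A : set Z) : measurable A ->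
  measurable_fun [set: measure_space] (fun m : measure_space => (m : measures) A).
Proof.
move=> mA _ B mB; rewrite setTI; apply: sub_sigma_algebra.
by exists A, B.
Qed.

Context {dO : measure_display} {Omega : measurableType dO}.
Variable eta : R.-ker Omega ~> Z.

Lemma measurable_kernel_measure :
  measurable_fun [set: Omega] (fun w => eta w : measure_space).
Proof.
apply: (@measurability _ _ _ measure_space _ _ evaluation_sets) => //.
move=> _ [_ [A [B [mA mB ->]]] <-].
by have := measurable_kernel eta A mA; apply.
Qed.

Lemma measurable_representative (f : measures -> R) :
  (forall B : set R, measurable B -> @evaluation_sigma_algebra d Z R (f @^-1` B)) ->
  measurable_fun [set: Omega] (fun w => f (eta w)).
Proof.
move=> mf; have mf' : measurable_fun [set: measure_space] (f : measure_space -> R).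
  by move=> _ B mB; rewrite setTI; exact: mf.
exact: (measurableT_comp mf' measurable_kernel_measure).
Qed.

Lemma representative_ek (P : probability Omega R) (mu : set Z -> \bar R)
    (g : elementary_kernel mu) :
  exists f, representative P eta (ek_integral eta g) f.
Proof.
pose X i (m : measure_space) : R :=
  fine ((m : measures) (ek_set g i)) - fine (mu (ek_set g i)).
pose f (m : measure_space) := \sum_i \sum_j ek_coef g i j * X i m * X j m.
exists f; split; last by apply/aeW.
have mX i : measurable_fun [set: measure_space] (X i).
  apply: measurable_funB => //; apply: measurableT_comp => //.
  by apply: measurable_evaluation; exact: ek_measurable.
have mf : measurable_fun [set: measure_space] f.
  apply: measurable_sum => i; apply: measurable_sum => j.
  by apply: measurable_funM => //; exact: measurable_funM.
by move=> B mB; have := mf measurableT B mB; rewrite setTI.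
Qed.

End measure_space.

Section J4.
Context {d : measure_display} {Z : measurableType d} {R : realType}.
Variable mu : {finite_measure set Z -> \bar R}.
Local Notation P := (poisson_process mu).
Local Notation eta := (points_kernel Z R).

Lemma ge0_integral_poisson_process_nil (h : config Z -> \bar R) :
  measurable_fun setT h -> (forall w, 0 <= h w)%E ->
  ((expR (- fine (mu setT)))%:E * h [::] <= \int[P]_w h w)%E.
Proof.
move=> mh h0; rewrite ge0_integral_poisson_process//.
apply: le_trans (nneseries_lim_ge 1 _) => [|n _ _]; last first.
  by rewrite mule_ge0 ?integral_ge0 ?lee_fin ?poisson_weight_ge0.
by rewrite big_nat1 fact0 divr1 /= integral_dirac// diracT mul1e.
Qed.

Lemma negligible_one_point (S : set (config Z)) : measurable S -> P S = 0%E ->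
  mu [set z | S [:: z]] = 0%E.
Proof.
move=> mS PS; have mS1 : measurable [set z | S [:: z]].
  by have := measurable_config1 measurableT mS; rewrite setTI.
have : ((expR (- fine (mu setT)))%:E * n_points_law mu 1 S <= 0)%E.
  rewrite -PS poisson_processE.
  apply: le_trans (nneseries_lim_ge 2 _) => [|n _ _]; last first.
    by rewrite mule_ge0 ?lee_fin ?poisson_weight_ge0.
  rewrite big_nat_recl// big_nat1 fact0 !divr1 leeDr//.
  by rewrite mule_ge0 ?lee_fin ?expR_ge0.
rewrite pmule_rle0 ?lte_fin ?expR_gt0// => S0.
have mI : measurable_fun [set: config Z] (fun w => (\1_S w)%:E : \bar R).
  by apply/measurable_EFinP; exact: measurable_indic.
apply/eqP; rewrite -measure_le0; apply: le_trans S0.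
rewrite le_eqVlt; apply/orP; left; apply/eqP.
transitivity (\int[mu]_z (\1_[set z | S [:: z]] z)%:E)%E.
  by rewrite integral_indic// setIT.
transitivity (\int[n_points_law mu 1]_w (\1_S w)%:E)%E; last first.
  by rewrite integral_indic// setIT.
rewrite [RHS]ge0_integral_add_random_point//.
apply: eq_integral => z _; rewrite integral_dirac//; last first.
  exact: (measurableT_comp mI (measurable_cons_point z)).
by rewrite diracT mul1e.
Qed.

(** The empty configuration has positive probability, so the expectation of
    |D_z F| ^ 4 is at least a positive multiple of its value there, which
    compares [:: z] with [::]. Every representative agrees with F at [::] and,
    because the process consists of a single point of law proportional to mu
    with positive probability, at [:: z] for mu-almost every z. *)
Lemma J4_gt0 (F : config Z -> R) (f : {measure set Z -> \bar R} -> R)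
    (B : set Z) (e : R) :
  representative P eta F f -> measurable B -> (0 < mu B)%E -> 0 < e ->
  (forall z, B z -> e <= `|F [:: z] - F [::]|) ->
  (0 < J4 P mu eta f)%E.
Proof.
move=> [mf [S [mS PS FS]]] mB B0 e0 Be.
have mfe := measurable_representative eta mf.
have S0 : ~ S [::].
  move=> Snil; have := poisson_process_nil mu; rewrite ltNge => /negP; apply.
  rewrite -PS; apply: le_measure; rewrite ?inE//; first exact: measurable_set1_nil.
  by move=> _ ->.
have FE w : ~ S w -> F w = f (eta w) by move=> /contra_notP Sw; apply: Sw => /FS.
pose S1 := [set z | S [:: z]].
have mS1 : measurable S1.
  by have := measurable_config1 measurableT mS; rewrite setTI.
have muS1 : mu S1 = 0%E by exact: negligible_one_point.
pose D (p : Z * config Z) : \bar R := (`|add_one eta f p.1 p.2| ^+ 4)%:E.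
have mD : measurable_fun setT D.
  apply/measurable_EFinP; apply: measurable_funX; apply: measurableT_comp => //.
  apply: measurable_funB.
    exact: (measurableT_comp mfe measurable_cons_config).
  exact: (measurableT_comp mfe measurable_snd).
have D0 p : (0 <= D p)%E by rewrite lee_fin exprn_ge0.
have -> : J4 P mu eta f = (\int[mu]_z fubini_F P D z)%E.
  by rewrite /J4; apply: eq_integral => z _; rewrite expectation.unlock.
pose k := expR (- fine (mu setT)) * e ^+ 4.
have k0 : 0 < k by rewrite mulr_gt0 ?expR_gt0 ?exprn_gt0.
apply: (@lt_le_trans _ _ (\int[mu]_(z in B `\` S1) k%:E)%E).
  rewrite integral_cst//=; last exact: measurableD.
  rewrite mule_gt0 ?lte_fin// measureD//; last by rewrite ltey_eq fin_num_measure.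
  rewrite [X in (_ < _ - X)%E](_ : _ = 0%E) ?sube0//.
  by apply: (subset_measure0 _ mS1 _ muS1) => //; exact: measurableI.
apply: (@le_trans _ _ (\int[mu]_(z in B `\` S1) fubini_F P D z)%E); last first.
  apply: ge0_subset_integral => //; first exact: measurableD.
    exact: measurable_fun_fubini_tonelli_F.
  by move=> z _; exact: integral_ge0.
apply: ge0_le_integral => //; first exact: measurableD.
- by move=> z _; rewrite lee_fin ltW.
- by apply: measurable_funTS; exact: measurable_fun_fubini_tonelli_F.
move=> z [Bz Sz].
apply: le_trans (ge0_integral_poisson_process_nil _ _) => //; last first.
  exact: (measurableT_comp mD (pair1_measurable z)).
rewrite /k EFinM lee_wpmul2l ?lee_fin ?expR_ge0// /D /=.
rewrite ?lee_fin lerXn2r ?nnegrE ?(ltW e0)//.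
apply: (le_trans (Be _ Bz)); rewrite FE// FE//.
Qed.

End J4.

Section centered_gamma.
Context {R : realType}.

Lemma centered_gamma_law_set1 (nu x : R) : centered_gamma_law nu [set x] = 0%E.
Proof.
rewrite /centered_gamma_law /pushforward /gamma_prob.
rewrite [X in (\int[_]_(_ in X) _)%E](_ : _ = [set (x + nu) / 2]).
  exact: integral_set1.
by apply/seteqP; split => y /=; [move=> <-|move=> ->]; lra.
Qed.

(** The law of a functional of the process has an atom at its value on the
    empty configuration. *)
Lemma distribution_neq_centered_gamma {d} {Z : measurableType d}
    (mu : {finite_measure set Z -> \bar R}) (F : {RV (poisson_process mu) >-> R})
    (nu : R) :
  ~ same_law (distribution (poisson_process mu) F) (centered_gamma_law nu).
Proof.
move=> /(_ [set F [::]] (measurable_set1 _)); rewrite centered_gamma_law_set1.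
apply/eqP; rewrite gt_eqF//.
apply: (lt_le_trans (poisson_process_nil mu)); apply: le_measure; rewrite ?inE.
- exact: measurable_set1_nil.
- exact: (measurable_funPTI F (measurable_set1 (F [::]))).
- by move=> w /= ->.
Qed.

End centered_gamma.
(** * The functional *)

Section paired_intervals.
Context {R : realType}.
Variables (n : nat) (l r : R).
Hypotheses (l01 : 0 < l < 1) (r01 : 0 < r < 1).

Local Notation mu := (@interval_measure R (n + n)).
Local Notation P := (poisson_process mu).
Local Notation eta := (points_kernel (measurableTypeR R) R).

Definition pair_length (i : 'I_(n + n)) : R :=
  match fintype.split i with inl _ => l | inr _ => r end.

Lemma pair_length01 i : 0 < pair_length i < 1.
Proof. by rewrite /pair_length; case: (fintype.split i). Qed.

Lemma pair_length_lshift k : pair_length (lshift n k) = l.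
Proof. by rewrite /pair_length -[lshift n k]/(unsplit (inl k)) unsplitK. Qed.

Lemma pair_length_rshift k : pair_length (rshift n k) = r.
Proof. by rewrite /pair_length -[rshift n k]/(unsplit (inr k)) unsplitK. Qed.

Local Notation A := (cell pair_length).
Local Notation c := (member_index A).

Lemma measurable_pair_index i : measurable (c @^-1` [set i]).
Proof.
apply: measurable_member_index; first exact: measurable_cell.
exact: (trivIset_cell pair_length01).
Qed.

Lemma cell_mass_pair i : cell_mass mu c (Some i) = pair_length i.
Proof.
rewrite /cell_mass member_index_Some; last first.
  exact: (trivIset_cell pair_length01).
rewrite -[RHS]/(fine (pair_length i)%:E); congr fine.
exact: (interval_measure_cell pair_length01).
Qed.

(** Each pair occurs in both triangles of the matrix, so the entries are half
    of the factor 4 of the functional. *)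
Definition pair_coef : 'M[R]_(n + n) := block_mx 0 2%:M 2%:M 0.

Lemma pair_coef_sym : pair_coef^T = pair_coef.
Proof. by rewrite /pair_coef tr_block_mx !trmx0 !tr_scalar_mx. Qed.

Lemma pair_coef_diag i : pair_coef i i = 0.
Proof.
rewrite /pair_coef; have := splitK i; case: (fintype.split i) => k /= <-.
- by rewrite block_mxEul mxE.
- by rewrite block_mxEdr mxE.
Qed.

Definition pair_kernel : elementary_kernel mu.
Proof.
refine (@ElementaryKernel _ (measurableTypeR R) R mu (n + n) A pair_coef _ _ _ _ _).
- exact: measurable_cell.
- by move=> i; rewrite [ltLHS](interval_measure_cell pair_length01) ltry.
- exact: (trivIset_cell pair_length01).
- exact: pair_coef_sym.
- exact: pair_coef_diag.
Defined.

Definition pairs : seq (option 'I_(n + n) * option 'I_(n + n)) :=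
  [seq (Some (lshift n k), Some (rshift n k)) | k <- enum 'I_n].

Definition paired_chaos (w : config (measurableTypeR R)) : R :=
  product_sum mu c 4 pairs (counts c w).

Lemma measurable_paired_chaos : measurable_fun setT paired_chaos.
Proof. exact: (measurable_fun_counts measurable_pair_index). Qed.

Lemma compensated_pair i w :
  compensated mu eta (A i) w = compensated_count mu c (Some i) (counts c w).
Proof.
rewrite /compensated /compensated_count points_kernelE cell_mass_pair.
rewrite counts_member_index; last exact: (trivIset_cell pair_length01).
by rewrite interval_measure_cell//; exact: pair_length01.
Qed.

Lemma paired_chaosE w : paired_chaos w = ek_integral eta pair_kernel w.
Proof.
rewrite /ek_integral /= big_split_ord /= -big_split /=.
rewrite /paired_chaos /product_sum /pairs big_map big_enum /=.
apply: eq_bigr => k _; rewrite !compensated_pair.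
rewrite !big_split_ord/=.
under eq_bigr do rewrite block_mxEul mxE !mul0r.
under [X in _ = _ + X + _]eq_bigr do rewrite block_mxEur mxE compensated_pair.
under [X in _ = _ + (X + _)]eq_bigr do rewrite block_mxEdl mxE compensated_pair.
under [X in _ = _ + (_ + X)]eq_bigr do rewrite block_mxEdr mxE !mul0r.
rewrite !big1_eq ?add0r ?addr0 (bigD1 k)//= big1 ?addr0; last first.
  by move=> j jk; rewrite eq_sym (negbTE jk) mulr0n !mul0r.
rewrite (bigD1 k)//= big1 ?addr0; last first.
  by move=> j jk; rewrite eq_sym (negbTE jk) mulr0n !mul0r.
by rewrite eqxx mulr1n; ring.
Qed.

Lemma paired_chaos_moments :
  let L := n%:R * (16 * (l * r)) in
  [/\ 'E_P[fun w => (paired_chaos w ^+ 2)%R]%E = L%:E,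
      'E_P[fun w => (paired_chaos w ^+ 3)%R]%E = (4 * L)%:E &
      'E_P[fun w => (paired_chaos w ^+ 4)%R]%E =
        (16 * L * (1 + 3 * (l + r) + 6 * (l * r)) + 3 * L ^+ 2)%:E].
Proof.
move=> L.
have up : uniq (unzip1 pairs ++ unzip2 pairs).
  have -> : unzip1 pairs = [seq Some (lshift n k) | k <- enum 'I_n].
    by rewrite /unzip1 /pairs -map_comp.
  have -> : unzip2 pairs = [seq Some (rshift n k) | k <- enum 'I_n].
    by rewrite /unzip2 /pairs -map_comp.
  rewrite cat_uniq; apply/and3P; split.
  - by rewrite map_inj_uniq ?enum_uniq// => i j [] /val_inj.
  - apply/hasPn => _ /mapP[k _ ->]; apply/negP => /mapP[j _ []] /eqP.
    by rewrite eq_sym -[_ == _]/(lshift n j == rshift n k) eq_lrshift.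
  - by rewrite map_inj_uniq ?enum_uniq// => i j [] /addnI /val_inj.
have mp p : p \in pairs -> cell_mass mu c p.1 = l /\ cell_mass mu c p.2 = r.
  move=> /mapP[k _ ->] /=; rewrite !cell_mass_pair.
  by rewrite pair_length_lshift pair_length_rshift.
have [_ M2 M3 M4] := mean_product_sum_pow measurable_pair_index 4 up mp.
have sz : size pairs = n by rewrite size_map size_enum_ord.
have E p : 'E_P[fun w => (paired_chaos w ^+ p)%R]%E =
    (mean mu c (fun v => product_sum mu c 4 pairs v ^+ p))%:E.
  rewrite -(mean_expectation mu measurable_pair_index)//.
  by apply: exp_boundedX; exact: exp_bounded_product_sum.
rewrite !E M2 M3 M4 sz /L /poisson_moment /=.
split; congr EFin; ring.
Qed.

(** The point z raises the compensated count of the left interval of pair k by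
    one; its partner, still without points, has compensated count - r. *)
Lemma paired_chaos_jump k z : A (lshift n k) z ->
  paired_chaos [:: z] - paired_chaos [::] = - (4 * r).
Proof.
move=> Az; have cz : c z = Some (lshift n k).
  have : (c @^-1` [set Some (lshift n k)]) z.
    by rewrite member_index_Some//; exact: (trivIset_cell pair_length01).
  by [].
rewrite /paired_chaos counts_cons cz counts_nil /product_sum /pairs -sumrB big_map.
have rl j : Some (rshift n j) != Some (lshift n k) :> option 'I_(n + n).
  by rewrite (inj_eq Some_inj) eq_rlshift.
have ll j : j != k -> Some (lshift n j) != Some (lshift n k) :> option 'I_(n + n).
  by rewrite (inj_eq Some_inj) (inj_eq (@lshift_inj _ _)).
rewrite big_enum /= (bigD1 k)//= big1 ?addr0; last first.
  move=> j jk; rewrite (X_incr_neq mu c _ (ll _ jk)) (X_incr_neq mu c _ (rl j)).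
  exact: subrr.
rewrite X_incr (X_incr_neq mu c _ (rl k)).
rewrite /compensated_count !ffunE !cell_mass_pair.
by rewrite pair_length_lshift pair_length_rshift; ring.
Qed.

End paired_intervals.

(** The two equations prescribe the product and the sum of l and r, which are
    thus the roots of a quadratic polynomial; its discriminant is nonnegative
    once the number of pairs is large compared with nu. *)
Lemma pair_lengths {R : realType} (nu : R) : 0 < nu ->
  exists n l r, [/\ (0 < n)%N, 0 < l < 1, 0 < r < 1,
    n%:R * (16 * (l * r)) = 2 * nu & 3 * (l + r) + 6 * (l * r) = 1 / 2].
Proof.
move=> nu0; pose n := (Num.truncn (21 * nu)).+1.
have n_nu : 21 * nu < n%:R.
  by have /andP[] := truncn_itv (ltW (mulr_gt0 (ltr0n R 21) nu0)).
have n0 : 0 < n%:R :> R by rewrite ltr0n.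
(* With e = nu / n the product is e / 8 and the sum S is 1 / 6 - e / 4. *)
pose e := nu / n%:R.
have e0 : 0 < e by rewrite divr_gt0.
have e21 : e < 1 / 21.
  by rewrite /e ltr_pdivrMr//; lra.
pose S := 1 / 6 - e / 4; pose D := S ^+ 2 - e / 2.
have D0 : 0 <= D by rewrite /D /S; nra.
have S0 : 0 < S by rewrite /S; lra.
pose q := Num.sqrt D.
have q0 : 0 <= q by exact: sqrtr_ge0.
have qD : q ^+ 2 = D by rewrite sqr_sqrtr.
have qS : q < S.
  by rewrite -(ltr_pXn2r (n := 2))// ?nnegrE ?(ltW S0)// qD /D; lra.
have S1 : S < 1 by rewrite /S; lra.
have lrE : (S + q) / 2 * ((S - q) / 2) = e / 8.
  have -> : (S + q) / 2 * ((S - q) / 2) = (S ^+ 2 - q ^+ 2) / 4 by field.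
  by rewrite qD /D; lra.
exists n, ((S + q) / 2), ((S - q) / 2); split => //.
- apply/andP; split; lra.
- apply/andP; split; lra.
- rewrite lrE /e; field; exact: lt0r_neq0.
- by rewrite lrE /S; lra.
Qed.

Unset Implicit Arguments.

Theorem theorem1p4 (R : realType) (nu : R) (nu_gt0 : 0 < nu) :
  exists (dZ : measure_display) (Z : measurableType dZ)
         (mu : {sigma_finite_measure set Z -> \bar R})
         (dO : measure_display) (Omega : measurableType dO)
         (P : probability Omega R) (eta : R.-ker Omega ~> Z)
         (F : {RV P >-> R}),
    [/\ atomless mu, poisson_random_measure P mu eta & second_chaos mu eta F] /\
    [/\ 'E_P[fun w => (F w ^+ 2)%R]%E = (2 * nu)%:E,
        'E_P[fun w => (F w ^+ 3)%R]%E = (8 * nu)%:E &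
        'E_P[fun w => (F w ^+ 4)%R]%E = (12 * nu ^+ 2 + 48 * nu)%:E] /\
    ~ same_law (distribution P F) (centered_gamma_law nu) /\
    (exists f, representative P eta F f) /\
    (forall f, representative P eta F f -> (0 < J4 P mu eta f)%E).
Proof.
have [n [l [r [n0 l01 r01 varE sumE]]]] := pair_lengths nu_gt0.
pose mu : {finite_measure set measurableTypeR R -> \bar R} := @interval_measure R (n + n).
pose F : {RV (poisson_process mu) >-> R} := HB.pack (@paired_chaos R n l r)
  (isMeasurableFun.Build _ _ _ _ (@paired_chaos R n l r)
     (@measurable_paired_chaos R n l r l01 r01)).
exists _, (measurableTypeR R), mu, _, (config (measurableTypeR R)),
  (poisson_process mu), (points_kernel (measurableTypeR R) R), F.
have [M2 M3 M4] := paired_chaos_moments n l01 r01.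
split; [split|split; [split|split; [|split]]].
- exact: interval_measure_atomless.
- exact: poisson_process_is_prm.
- by apply: second_chaos_elementary => w; exact: paired_chaosE.
- by rewrite M2 varE.
- by rewrite M3 varE; congr EFin; ring.
- by rewrite M4 varE -addrA sumE; congr EFin; field.
- exact: distribution_neq_centered_gamma.
- have [f fP] := representative_ek (points_kernel _ R) (poisson_process mu) (pair_kernel n l01 r01).
  exists f; rewrite (_ : (F : _ -> R) = ek_integral (points_kernel _ R) (pair_kernel n l01 r01))//.
  by apply/funext => w; exact: paired_chaosE.
- move=> f Ff; pose k := Ordinal n0.
  have /andP[r0 _] := r01.
  apply: (J4_gt0 (B := cell (pair_length l r) (lshift n k)) (e := 4 * r) Ff).
  + exact: measurable_cell.
  + rewrite [ltRHS](interval_measure_cell (@pair_length01 R n l r l01 r01)).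
    by rewrite pair_length_lshift lte_fin; have /andP[] := l01.
  + by rewrite mulr_gt0.
  + by move=> z /(paired_chaos_jump l01 r01) ->; rewrite normrN ger0_norm// mulr_ge0// ltW.
Qed.
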